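(* For every $0<\varepsilon<1/2$ there exist real numbers $k_\varepsilon$, $K_\varepsilon$ and $h_\varepsilon$ such that the following holds. Let $G=\mathbb{F}_p$ for a prime $p$ or $G=\mathbb{R}$, and let $X$ and $Y$ be independent discrete random variables taking values in $G$ with $H(X)\ge h_\varepsilon$. If $G=\mathbb{F}_p$, suppose further that $\log p\ge k_\varepsilon + K_\varepsilon$ and $k_\varepsilon < H(X) < \log p - K_\varepsilon$. Then $$H(X+Y) \ge \frac12 H(X) + \frac12 H(Y) + \frac18 - \varepsilon.$$
   Context: All logarithms are to base $2$; $H$ denotes Shannon entropy $H(X)=-\sum_x\Pr(X=x)\log\Pr(X=x)$. *)

(* Defs.v *)
From HB Require Import structures.
From mathcomp Require Import all_boot all_order all_algebra.
From mathcomp Require Import all_classical all_reals all_analysis.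

Set Implicit Arguments.
Unset Strict Implicit.
Unset Printing Implicit Defensive.

Import Order.TTheory GRing.Theory Num.Theory.
Import numFieldNormedType.Exports.

Local Open Scope classical_set_scope.
Local Open Scope ring_scope.

(* 'F_p is convertible to an ordinal type 'I_n.+1, which MathComp-Analysis
   leaves without a sigma-algebra; it gets the one of all subsets. *)
HB.instance Definition _ (n : nat) := isPointed.Build 'I_n.+1 ord0.

HB.instance Definition _ (n : nat) :=
  @isMeasurable.Build default_measure_display 'I_n.+1
    discrete_measurable discrete_measurable0
    discrete_measurableC discrete_measurableU.

Definition log2 (R : realType) (x : R) : R := ln x / ln 2.

(* The sum ranges over all of G and has nonnegative terms, so it is the
   supremum of its finite partial sums, possibly +oo.
   Since ln 0 = 0, values of probability zero contribute 0. *)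
Definition entropy (d : measure_display) (T : measurableType d) (R : realType)
    (P : probability T R) (G : choiceType) (X : T -> G) : \bar R :=
  \esum_(x in [set: G])
    (- (fine (P (X @^-1` [set x])) * log2 (fine (P (X @^-1` [set x])))))%:E.

Definition independent_RV (d d1 d2 : measure_display) (T : measurableType d)
    (G1 : measurableType d1) (G2 : measurableType d2) (R : realType)
    (P : probability T R) (X : {RV P >-> G1}) (Y : {RV P >-> G2}) : Prop :=
  forall (A : set G1) (B : set G2), measurable A -> measurable B ->
    P (X @^-1` A `&` Y @^-1` B) = (P (X @^-1` A) * P (Y @^-1` B))%E.
Arguments independent_RV {d d1 d2 T G1 G2 R} P X Y.

(* Main.v *)
Require Import Defs.
From mathcomp Require Import all_boot all_order all_algebra.
From mathcomp Require Import ring lra zify.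

(* For X and Y on a finite subset of an ordered group and without large atoms,
   split each law at its median into halves X1, X2 and Y1, Y2.  The laws of
   X1 + Y1 and X2 + Y2 live on opposite sides of the sum z0 of the medians, so
   the sign of X + Y - z0 predicts the halves of X and of Y with an average success
   probability of at least 3/4, up to the atom at z0; by Gibbs' inequality
   H(X+Y) >= (H(X) + H(Y))/2 + 1 - h(1/4), where h is the binary entropy, and
   1 - h(1/4) = 3/4 log 3 - 1 > 1/8.
   A large atom, or entropies of X and Y that differ by 1/4, give the gain
   by concavity alone; on R the laws are then truncated to finite sets.
   On F_p, a law with mass spread outside its floor(p/2) largest values also gives
   the gain by concavity, since H(X) is far below log p.  Otherwise restrict to
   these values.  By Pollard's theorem the law of X + Y is then majorized by that of
   the sum of unimodal rearrangements of X and Y on the integers, to which the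
   ordered case applies. *)

Set Implicit Arguments.
Unset Strict Implicit.
Unset Printing Implicit Defensive.

Import Order.TTheory GRing.Theory Num.Theory.

(** * Pollard's theorem *)

Section Pollard.
Local Open Scope nat_scope.
Context {G : finZmodType}.
Implicit Types A B S : {set G}.

(** A law is a weight on a finite index type, placed in the group by an injection [u] or [v]. This
    separates weights from positions: [cross_ge] and [ordered_gain] serve the reals and the integers
    alike, and a rearrangement changes only the positions, never [f] and [g]. The obstacle on F_p is
    that sums wrap around, so that no median splits them. Pollard's bound controls the sums of two
    sets only while their sizes add up to at most p; this is why both laws are first cut down to
    their floor(p/2) largest values. The ordered gain 3/4 log 3 - 1 exceeds 1/8 by about 0.06. This
    slack pays for the atom at the sum of the medians, for the rearrangement and for the
    restriction, so that all finite cases give the full 1/8; [eps] is spent only on truncating laws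
    on R. *)

Definition nrep A B (x : G) : nat := \sum_(a in A) \sum_(b in B) ((a + b)%R == x).

Lemma nrep_le_l A B x : nrep A B x <= #|A|.
Proof.
rewrite -sum1_card; apply: leq_sum => a _.
apply: (@leq_trans (\sum_(b : G) ((a + b)%R == x))).
  by rewrite [leqRHS](bigID (mem B)) leq_addr.
rewrite (bigD1 (x - a)%R) //= big1 ?addn0 ?leq_b1 // => b bx.
by apply/eqP; rewrite eqb0; apply: contra bx => /eqP <-; rewrite addrC addKr.
Qed.

Lemma nrepC A B x : nrep A B x = nrep B A x.
Proof.
rewrite /nrep exchange_big /=; apply: eq_bigr => b _; apply: eq_bigr => a _.
by rewrite addrC.
Qed.

Lemma nrep_le_r A B x : nrep A B x <= #|B|.
Proof. by rewrite nrepC nrep_le_l. Qed.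

Lemma sum_nrep A B : \sum_x nrep A B x = #|A| * #|B|.
Proof.
rewrite exchange_big /= -sum_nat_const; apply: eq_bigr => a _.
rewrite exchange_big /= -sum1_card; apply: eq_bigr => b _.
by rewrite (bigD1 (a + b)%R) //= eqxx big1 ?addn0 // => x; rewrite eq_sym => /negbTE ->.
Qed.

(* The e-transform: with I, U the intersection and union of A and B,
   1_A * 1_B = 1_U * 1_I + 1_(A \ I) * 1_(B \ I). *)
Lemma nrep_dyson A B x :
  nrep A B x = nrep (A :|: B) (A :&: B) x + nrep (A :\: B) (B :\: A) x.
Proof.
pose F (C D : {set G}) := \sum_(a in C) \sum_(b in D) ((a + b)%R == x).
have Fl (C C' D : {set G}) : [disjoint C & C'] -> F (C :|: C') D = F C D + F C' D.
  move=> CC; rewrite /F (eq_bigl [predU C & C']) ?bigU //.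
  by move=> y; rewrite !inE.
have FC (C D : {set G}) : F C D = F D C by apply: nrepC.
have Fr (C D D' : {set G}) : [disjoint D & D'] -> F C (D :|: D') = F C D + F C D'.
  by move=> DD; rewrite FC Fl // !(FC C).
have dA : [disjoint A :\: B & A :&: B].
  by rewrite -setI_eq0; apply/eqP/setP => y; rewrite !inE; case: (y \in B); rewrite /= ?andbF.
have dB : [disjoint B :\: A & A :&: B].
  by rewrite -setI_eq0; apply/eqP/setP => y; rewrite !inE; case: (y \in A); rewrite /= ?andbF.
have dU : [disjoint (A :\: B) :|: (A :&: B) & B :\: A].
  by rewrite -setI_eq0; apply/eqP/setP => y; rewrite !inE; case: (y \in A); case: (y \in B).
have EA : A = (A :\: B) :|: (A :&: B).
  by apply/setP => y; rewrite !inE; case: (y \in A); case: (y \in B).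
have EB : B = (B :\: A) :|: (A :&: B).
  by apply/setP => y; rewrite !inE; case: (y \in A); case: (y \in B).
have EU : A :|: B = ((A :\: B) :|: (A :&: B)) :|: (B :\: A).
  by apply/setP => y; rewrite !inE; case: (y \in A); case: (y \in B).
rewrite -![nrep _ _ _]/(F _ _) EU (Fl _ _ _ dU) (Fl _ _ _ dA).
have -> : F A B = F ((A :\: B) :|: (A :&: B)) ((B :\: A) :|: (A :&: B)).
  by rewrite -EA -EB.
rewrite (Fl _ _ _ dA) !(Fr _ _ _ dB) (FC (B :\: A) (A :&: B)); lia.
Qed.

Definition translate e B : {set G} := [set (b + e)%R | b in B].

Lemma card_translate e B : #|translate e B| = #|B|.
Proof. by rewrite card_imset //; exact: addIr. Qed.

Lemma nrep_translate e A B x : nrep A (translate e B) (x + e)%R = nrep A B x.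
Proof.
apply: eq_bigr => a _; rewrite big_imset /=; last by move=> ? ? _ _ /addIr.
by apply: eq_bigr => b _; rewrite addrA (inj_eq (addIr e)).
Qed.

(** For a finite group this says that 0 and G are the only subgroups. It is all that Pollard's
    theorem uses of F_p. *)
Definition no_period := forall A (d : G), d != 0%R -> A != set0 ->
  (forall a, a \in A -> (a + d)%R \in A) -> A = setT.

(** If every translate of [B] that meets [A] were contained in [A], then [A] would be closed under
    adding the difference of two elements of [B]. *)
Lemma good_translate A B : no_period -> A != set0 -> A != setT -> 1 < #|B| ->
  exists e, 0 < #|A :&: translate e B| < #|B|.
Proof.
move=> np A0 AT /card_gt1P [b1 [b2 [b1B b2B b12]]].
case: (pickP (fun e => 0 < #|A :&: translate e B| < #|B|)) => [e He|no]; first by exists e.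
case/eqP: AT; apply: (np A (b2 - b1)%R) => //; first by rewrite subr_eq0 eq_sym.
move=> a aA; have := no (a - b1)%R; rewrite -(card_translate (a - b1) B).
have aT : a \in translate (a - b1) B.
  by apply/imsetP; exists b1; rewrite // addrC subrK.
have -> : 0 < #|A :&: translate (a - b1) B|.
  by apply/card_gt0P; exists a; rewrite inE aA.
rewrite /= => /negbT; rewrite -leqNgt => le.
have /eqP/setIidPr sub : A :&: translate (a - b1) B == translate (a - b1) B.
  by rewrite eqEcard subsetIr.
apply: (subsetP sub); apply/imsetP; exists b2 => //.
by rewrite addrCA addrA.
Qed.

(** Here [m] and [U] are the sizes of the intersection and the union. The two sides are in fact
    equal. *)
Lemma pollard_step (i j m t U : nat) : U + m = i + j -> m < t -> t <= i -> t <= j ->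
  t * (i + j - t) <= U * m + (t - m) * (i - m + (j - m) - (t - m)).
Proof.
move=> Um mt ti tj.
have [t' Et] : exists t', t = m + t' by exists (t - m); lia.
have [i' Ei] : exists i', i = m + t' + i' by exists (i - t); lia.
have [j' Ej] : exists j', j = m + t' + j' by exists (j - t); lia.
have EU : U = m + t' + t' + i' + j' by lia.
have E1 : i + j - t = m + t' + i' + j' by lia.
have E2 : i - m + (j - m) - (t - m) = t' + i' + j' by lia.
by rewrite E1 E2 Et EU addKn !mulnDl !mulnDr; lia.
Qed.

(** Induction on the size of [B] by the e-transform: for a translate [B'] of [B] that meets [A]
    partially, both [A :&: B'] and [B' :\: A] are smaller than [B]. *)
Lemma pollard A B t : no_period -> #|A| + #|B| <= #|G| -> t <= #|A| -> t <= #|B| ->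
  t * (#|A| + #|B| - t) <= \sum_x minn t (nrep A B x).
Proof.
move=> np; have [n] := ubnP #|B|; elim: n A B t => // n IH A B t ltn AB tA tB.
have [->|t0] := posnP t; first by rewrite mul0n.
have [tE|tB'] := eqVneq t #|B|.
  rewrite {3}tE (eq_bigr (nrep A B)); last by move=> x _; apply/minn_idPr; rewrite nrep_le_r.
  by rewrite sum_nrep tE addnK mulnC.
have {tB'} tltB : t < #|B| by rewrite ltn_neqAle tB'.
have A0 : A != set0 by rewrite -card_gt0 (leq_trans t0).
have AT : A != setT.
  by apply: contraTneq AB => ->; rewrite cardsT -ltnNge -[ltnLHS]addn0 ltn_add2l (leq_ltn_trans _ tltB).
have B1 : 1 < #|B| by apply: leq_trans tltB.
have [e] := good_translate np A0 AT B1.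
rewrite -(card_translate e B); set B' := translate e B => /andP[I0 IB].
rewrite (reindex_inj (addIr (- e)%R)) /=.
under eq_bigr => x _ do rewrite -(nrep_translate e) subrK.
rewrite -/B'.
have cB' : #|B'| = #|B| by exact: card_translate.
have cU : #|A :|: B'| + #|A :&: B'| = #|A| + #|B'| by rewrite cardsUI.
have cA' : #|A :\: B'| = #|A| - #|A :&: B'| by rewrite cardsD.
have cB'' : #|B' :\: A| = #|B'| - #|A :&: B'| by rewrite cardsD setIC.
have IA : #|A :&: B'| <= #|A| by rewrite subset_leq_card // subsetIl.
(* A large intersection: by [nrep_dyson] the pair of union and intersection alone suffices, with the
   same [t]. *)
have [tI|It] := leqP t #|A :&: B'|.
  have := IH (A :|: B') (A :&: B') t; rewrite cU cB'.
  move=> H; apply: leq_trans (H _ _ _ tI) _.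
  - by rewrite -ltnS (leq_trans _ ltn) // ltnS -cB'.
  - by [].
  - by apply: leq_trans tA _; rewrite subset_leq_card // subsetUl.
  apply: leq_sum => x _; rewrite leq_min geq_minl /=.
  by rewrite (leq_trans (geq_minr _ _)) // [leqRHS]nrep_dyson leq_addr.
(* A small intersection: its representation counts stay below [t] and enter in full, and the
   differences are truncated at what remains of [t]. *)
have := IH (A :\: B') (B' :\: A) (t - #|A :&: B'|).
rewrite cA' cB'' cB' => H.
have {}H := H ltac:(lia) ltac:(lia) ltac:(lia) ltac:(lia).
apply: (@leq_trans (\sum_x (nrep (A :|: B') (A :&: B') x
   + minn (t - #|A :&: B'|) (nrep (A :\: B') (B' :\: A) x)))).
  rewrite big_split /= sum_nrep.
  apply: leq_trans (leq_add (leqnn _) H).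
  by apply: pollard_step => //; rewrite -?cB' // ltnW.
apply: leq_sum => x _.
have := nrep_le_r (A :|: B') (A :&: B') x; have := nrep_dyson A B' x; lia.
Qed.

(* From r <= t + (r - min(t, r)) summed over S; with S the set where r = nrep A B
   is largest, this controls the decreasing rearrangement of r. *)
Lemma sum_nrep_le A B S t : no_period -> #|A| + #|B| <= #|G| -> t <= #|A| -> t <= #|B| ->
  \sum_(x in S) nrep A B x + t * (#|A| + #|B| - t) <= t * #|S| + #|A| * #|B|.
Proof.
move=> np AB tA tB; have := pollard np AB tA tB; rewrite -sum_nrep mulnC.
have : \sum_(x in S) nrep A B x + \sum_x minn t (nrep A B x) <=
   #|S| * t + \sum_x nrep A B x.
  rewrite -sum_nat_const [X in X + _](big_mkcond (mem S)) [X in _ <= X + _](big_mkcond (mem S)).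
  rewrite -!big_split /=; apply: leq_sum => x _; case: (x \in S); lia.
rewrite [t * #|S|]mulnC; lia.
Qed.

End Pollard.

Lemma no_period_Fp p : prime p -> @no_period 'F_p.
Proof.
move=> pp A d d0 /set0Pn[a aA] Ad; apply/setP => x; rewrite inE.
have An n : (a + d *+ n)%R \in A.
  by elim: n => [|n IH]; rewrite ?mulr0n ?addr0 // mulrSr addrA Ad.
have -> : x = (a + d *+ ((x - a) / d)%R)%R.
  by rewrite -mulr_natl natr_Zp divfK // addrC subrK.
exact: An.
Qed.

From mathcomp Require Import all_classical all_reals all_analysis.

Local Open Scope ring_scope.

(** * Gibbs' inequality and entropies of sums *)

Section Log2.
Context {R : realType}.
Implicit Types x y b : R.

Lemma ln2_ge_half : 1 / 2 <= ln 2 :> R.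
Proof.
have : ln (1 + - (1 / 2)) <= - (1 / 2) :> R by apply: le_ln1Dx; lra.
rewrite (_ : 1 + - (1 / 2) = 2^-1 :> R); last by field.
by rewrite lnV ?posrE //; lra.
Qed.

Lemma ln2_gt0 : 0 < ln 2 :> R.
Proof. by have := ln2_ge_half; lra. Qed.

Lemma inv_ln2_le2 : (ln 2)^-1 <= 2 :> R.
Proof.
rewrite -[leRHS]invrK lef_pV2 ?posrE ?ln2_gt0 ?invr_gt0 //.
by have := ln2_ge_half; lra.
Qed.

Lemma log2M x y : 0 < x -> 0 < y -> log2 (x * y) = log2 x + log2 y.
Proof. by move=> x0 y0; rewrite /log2 lnM ?posrE // mulrDl. Qed.

Lemma log2V x : 0 < x -> log2 x^-1 = - log2 x.
Proof. by move=> x0; rewrite /log2 lnV ?posrE // mulNr. Qed.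

Lemma log2_div x y : 0 < x -> 0 < y -> log2 (x / y) = log2 x - log2 y.
Proof. by move=> x0 y0; rewrite log2M ?invr_gt0 // log2V. Qed.

Lemma log2_1 : log2 1 = 0 :> R.
Proof. by rewrite /log2 ln1 mul0r. Qed.

Lemma log2_X x n : 0 < x -> log2 (x ^+ n) = log2 x *+ n.
Proof. by move=> x0; rewrite /log2 lnXn // mulrnAl. Qed.

Lemma log2_pow2 n : log2 (2 ^+ n) = n%:R :> R.
Proof. by rewrite log2_X // /log2 divff // gt_eqF // ln2_gt0. Qed.

Lemma ler_log2 x y : 0 < x -> x <= y -> log2 x <= log2 y.
Proof.
move=> x0 xy; rewrite /log2 ler_pM2r ?invr_gt0 ?ln2_gt0 //.
by rewrite ler_ln ?posrE // (lt_le_trans x0).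
Qed.

Lemma log2_le_sub1 x : 0 < x -> log2 x <= (x - 1) / ln 2.
Proof.
move=> x0; rewrite /log2 ler_pM2r ?invr_gt0 ?ln2_gt0 //.
by have := @le_ln1Dx R (x - 1); rewrite (_ : 1 + (x - 1) = x); [apply; lra | ring].
Qed.

(** From 2^11 = 2048 <= 2187 = 3^7. It makes the gain 3/4 log 3 - 1 at least 5/28, about 0.05 above
    1/8. *)
Lemma log2_3_ge : 11 / 7 <= log2 3 :> R.
Proof.
have : log2 (2 ^+ 11) <= log2 (3 ^+ 7) :> R.
  by apply: ler_log2; rewrite ?exprn_gt0 // -!natrX ler_nat.
rewrite log2_pow2 log2_X // -mulr_natr; lra.
Qed.

Lemma log2_3_le2 : log2 3 <= 2 :> R.
Proof. by rewrite -(log2_pow2 2) ler_log2 // -natrX ler_nat. Qed.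

Definition plogp x := - (x * log2 x).

Lemma plogp0 : plogp 0 = 0.
Proof. by rewrite /plogp mul0r oppr0. Qed.

Lemma plogp_ge0 x : 0 <= x -> x <= 1 -> 0 <= plogp x.
Proof.
move=> x0 x1; rewrite /plogp -mulrN mulr_ge0 // oppr_ge0.
by rewrite /log2 mulr_le0_ge0 ?ln_le0 // invr_ge0 ltW // ln2_gt0.
Qed.

(** The right-hand side is the tangent at [b] of the concave function [plogp]; the elementary bounds
    below come from [b = 1] and [b = 2 ^- n]. *)
Lemma plogp_tangent x b : 0 <= x -> 0 < b ->
  plogp x <= - (x * log2 b) + (b - x) / ln 2.
Proof.
rewrite le_eqVlt => /predU1P[<-|x0] b0.
  by rewrite plogp0 mul0r oppr0 add0r addr0 divr_ge0 ?ltW ?ln2_gt0.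
have := log2_le_sub1 (divr_gt0 b0 x0).
rewrite log2_div // -(ler_pM2l x0) => H.
rewrite /plogp -subr_ge0.
have -> : - (x * log2 b) + (b - x) / ln 2 - - (x * log2 x)
   = x * ((b / x - 1) / ln 2) - x * (log2 b - log2 x).
  by field; rewrite !gt_eqF // ln2_gt0.
by rewrite subr_ge0.
Qed.

Lemma plogp_le_compl x : 0 <= x -> x <= 1 -> plogp x <= 2 * (1 - x).
Proof.
move=> x0 x1; have := plogp_tangent x0 (ltr01 : 0 < 1 :> R).
rewrite log2_1 mulr0 oppr0 add0r => /le_trans; apply.
by rewrite mulrC ler_wpM2r ?subr_ge0 // inv_ln2_le2.
Qed.

Lemma plogp_le2 x : 0 <= x -> x <= 1 -> plogp x <= 2.
Proof. by move=> x0 x1; have := plogp_le_compl x0 x1; lra. Qed.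

Lemma plogp_le_pow2 n x : 0 <= x -> x <= 2 ^- n ->
  plogp x <= (n%:R + 2) * 2 ^- n.
Proof.
move=> x0 xn; set e : R := 2 ^- n.
have e0 : 0 < e by rewrite invr_gt0 exprn_gt0.
have := plogp_tangent x0 e0.
rewrite log2V ?exprn_gt0 // log2_pow2 mulrN opprK => /le_trans; apply.
have H : (e - x) / ln 2 <= 2 * (e - x).
  by rewrite mulrC ler_wpM2r ?subr_ge0 // inv_ln2_le2.
have H2 : x * n%:R <= n%:R * e by rewrite mulrC ler_wpM2l.
rewrite -/e; lra.
Qed.

Lemma plogpM x y : 0 <= x -> 0 <= y -> plogp (x * y) = x * plogp y + y * plogp x.
Proof.
rewrite /plogp le_eqVlt => /predU1P[<-|x0]; first by rewrite !(mul0r,mulr0,oppr0,addr0).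
rewrite le_eqVlt => /predU1P[<-|y0]; first by rewrite !(mul0r,mulr0,oppr0,addr0).
rewrite log2M //; ring.
Qed.

Lemma plogp_concave x y a b : 0 <= x -> 0 <= y -> 0 <= a -> 0 <= b ->
  a + b = 1 -> a * plogp x + b * plogp y <= plogp (a * x + b * y).
Proof.
move=> x0 y0 a0 b0 ab; set m := a * x + b * y.
have ax0 : 0 <= a * x by rewrite mulr_ge0.
have by0 : 0 <= b * y by rewrite mulr_ge0.
have : 0 <= m by rewrite addr_ge0.
rewrite le_eqVlt => /predU1P[m0|m0].
  have Ea : a * x = 0 by rewrite /m in m0; lra.
  have Eb : b * y = 0 by rewrite /m in m0; lra.
  by rewrite -m0 plogp0 /plogp !mulrN !mulrA Ea Eb !mul0r oppr0 addr0.
have Hx := ler_wpM2l a0 (plogp_tangent x0 m0).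
have Hy := ler_wpM2l b0 (plogp_tangent y0 m0).
apply: (le_trans (lerD Hx Hy)).
rewrite le_eqVlt; apply/orP; left; apply/eqP.
transitivity (- ((a * x + b * y) * log2 m) + ((a + b) * m - (a * x + b * y)) / ln 2).
  by field; rewrite gt_eqF // ln2_gt0.
by rewrite ab mul1r -/m subrr mul0r addr0.
Qed.

(** In the applications [q] is the ratio of a reference weight to the true one. Nothing is
    normalized, so that parts of laws and tilted laws are allowed. *)
Lemma gibbs (K : finType) (a q : K -> R) :
  (forall k, 0 <= a k) -> (forall k, 0 < a k -> 0 < q k) ->
  \sum_k a k * log2 (q k) <= (\sum_k a k * q k - \sum_k a k) / ln 2.
Proof.
move=> a0 q0; rewrite -sumrB mulr_suml; apply: ler_sum => k _.
have := a0 k; rewrite le_eqVlt => /predU1P[<-|ak]; first by rewrite !mul0r subrr mul0r.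
rewrite -[in X in _ * _ - X](mulr1 (a k)) -mulrBr -mulrA ler_pM2l //.
exact/log2_le_sub1/q0.
Qed.

End Log2.

Definition ent {R : realType} {I : finType} (f : I -> R) : R :=
  \sum_i plogp (f i).

Definition pmass {R : realType} {K : finType} {T : eqType}
  (a : K -> R) (z : K -> T) (t : T) : R := \sum_(k | z k == t) a k.

(* The entropy of the image of the weights a under z, written as a sum over K
   so that the values of z need not be enumerated. *)
Definition pent {R : realType} {K : finType} {T : eqType}
  (a : K -> R) (z : K -> T) : R := - \sum_k a k * log2 (pmass a z (z k)).

Section Push.
Context {R : realType} {K : finType} {T : eqType}.
Variables (a : K -> R) (z : K -> T).
Hypothesis a_ge0 : forall k, 0 <= a k.

Lemma pmass_ge0 t : 0 <= pmass a z t.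
Proof. by rewrite sumr_ge0. Qed.

Lemma pmass_ge k : a k <= pmass a z (z k).
Proof. by rewrite /pmass (bigD1 k) //= lerDl sumr_ge0. Qed.

Lemma pmass_sum (s : seq T) (F : T -> R) : uniq s -> (forall k, z k \in s) ->
  \sum_k a k * F (z k) = \sum_(t <- s) pmass a z t * F t.
Proof.
move=> us zs; under [RHS]eq_bigr do rewrite /pmass mulr_suml big_mkcond /=.
rewrite exchange_big /=; apply: eq_bigr => k _.
rewrite (bigD1_seq (z k)) //= eqxx big1 ?addr0 // => t.
by rewrite eq_sym => /negbTE ->.
Qed.

Lemma pent_sum (s : seq T) : uniq s -> (forall k, z k \in s) ->
  pent a z = \sum_(t <- s) plogp (pmass a z t).
Proof.
move=> us zs.
by rewrite /pent (pmass_sum (fun t => log2 (pmass a z t)) us zs) -sumrN.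
Qed.

(** Entropy is at most cross entropy, by [gibbs] with [r] over the law. A reference weight of total
    above 1 is allowed at the price of the last term; [rearrangement] takes [c = 1 + d]. *)
Lemma pent_cross (s : seq T) (r : T -> R) c : uniq s -> (forall k, z k \in s) ->
  (forall t, 0 <= r t) -> (forall k, 0 < a k -> 0 < r (z k)) ->
  \sum_(t <- s) r t <= c ->
  pent a z <= - (\sum_k a k * log2 (r (z k))) + (c - \sum_k a k) / ln 2.
Proof.
move=> us zs r0 az rc.
have P k : 0 < a k -> 0 < pmass a z (z k) by move=> ak; apply: lt_le_trans (pmass_ge k).
have Q k : 0 < a k -> 0 < r (z k) / pmass a z (z k).
  by move=> ak; rewrite divr_gt0 ?az ?P.
have := gibbs a_ge0 Q.
have -> : \sum_k a k * log2 (r (z k) / pmass a z (z k))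
   = \sum_k a k * log2 (r (z k)) + pent a z.
  rewrite /pent -sumrB; apply: eq_bigr => k _.
  have := a_ge0 k; rewrite le_eqVlt => /predU1P[<-|ak]; first by rewrite !mul0r subrr.
  by rewrite log2_div ?az ?P // mulrBr.
have -> : \sum_k a k * (r (z k) / pmass a z (z k))
   = \sum_(t <- s) pmass a z t * (r t / pmass a z t).
  exact: (pmass_sum (fun t => r t / pmass a z t)).
have : \sum_(t <- s) pmass a z t * (r t / pmass a z t) <= c.
  apply: le_trans rc; apply: ler_sum => t _.
  have [->|m0] := eqVneq (pmass a z t) 0; first by rewrite mul0r.
  by rewrite mulrC divfK.
set X := \sum_(t <- s) _; set A := \sum_k a k => XC.
have : (X - A) / ln 2 <= (c - A) / ln 2.
  by rewrite ler_pM2r ?invr_gt0 ?ln2_gt0 // lerD2r.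
lra.
Qed.

Lemma pmass_inj_le (I : finType) (w : I -> T) (rho : T -> R) : injective w ->
  (forall t, 0 <= rho t) ->
  \sum_i pmass a z (w i) * rho (w i) <= \sum_k a k * rho (z k).
Proof.
move=> winj r0.
under eq_bigr do rewrite /pmass mulr_suml big_mkcond /=.
rewrite exchange_big /=; apply: ler_sum => k _.
have [i /eqP zi|zi] := pickP (fun i => z k == w i).
  rewrite (bigD1 i) //= zi eqxx big1 ?addr0 // => j ji.
  case: eqP => // /winj ij; by rewrite ij eqxx in ji.
by rewrite big1 ?mulr_ge0 // => i _; rewrite zi.
Qed.

End Push.

Definition prodw {R : realType} {I J : finType} (f : I -> R) (g : J -> R) : I * J -> R :=
  fun k => f k.1 * g k.2.

Definition sumz {G : zmodType} {I J : finType} (u : I -> G) (v : J -> G) : I * J -> G :=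
  fun k => u k.1 + v k.2.

Lemma mass_prodw {R : realType} {I J : finType} (f : I -> R) (g : J -> R) :
  \sum_k prodw f g k = (\sum_i f i) * (\sum_j g j).
Proof.
rewrite mulr_suml -(pair_bigA _ (fun i j => f i * g j)) /=.
by apply: eq_bigr => i _; rewrite mulr_sumr.
Qed.

Section Sum.
Context {R : realType} {G : zmodType} {I J : finType}.
Variables (f : I -> R) (g : J -> R) (u : I -> G) (v : J -> G).
Hypotheses (f_ge0 : forall i, 0 <= f i) (g_ge0 : forall j, 0 <= g j).

Local Notation law := (pmass (prodw f g) (sumz u v)).

Lemma prodw_ge0 k : 0 <= prodw f g k.
Proof. by rewrite mulr_ge0. Qed.

Hypothesis uinj : injective u.

(* For fixed j the points u i + v j are distinct, so the law of the sum, tilted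
   by rho, is an admissible reference weight for f' in Gibbs' inequality. *)
Lemma cross_ge (f' : I -> R) (g' : J -> R) (rho : G -> R) :
  (forall i, 0 <= f' i <= f i) -> (forall j, 0 <= g' j <= g j) ->
  (forall t, 0 < rho t) ->
  (\sum_j g' j) * (ent f' - plogp (\sum_i f' i))
    + \sum_k prodw f' g' k * log2 (rho (sumz u v k))
    - (\sum_i f' i) * (\sum_j g' j)
       * (\sum_k prodw f g k * rho (sumz u v k) - 1) / ln 2
  <= - \sum_k prodw f' g' k * log2 (law (sumz u v k)).
Proof.
move=> Hf Hg rho0.
have f'0 i : 0 <= f' i by case/andP: (Hf i).
have g'0 j : 0 <= g' j by case/andP: (Hg j).
set al := \sum_i f' i; set be := \sum_j g' j; set E := \sum_k prodw f g k * _.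
have a0 k : 0 <= prodw f' g' k by rewrite mulr_ge0.
have fpos k : 0 < prodw f' g' k -> 0 < f' k.1.
  by move=> h; rewrite lt_def f'0 andbT; apply: contraTneq h => h; rewrite /prodw h mul0r ltxx.
have alpos k : 0 < prodw f' g' k -> 0 < al.
  by move=> /fpos h; apply: (lt_le_trans h); rewrite /al (bigD1 k.1) //= lerDl sumr_ge0.
have lpos k : 0 < prodw f' g' k -> 0 < law (sumz u v k).
  move=> h; apply: (lt_le_trans h); apply: le_trans (pmass_ge _ prodw_ge0 k).
  by case/andP: (Hf k.1) => ? ?; case/andP: (Hg k.2) => ? ?; apply: ler_pM.
(* The ratio of the tilted law of the sum at [u i + v j] to the normalized weight [f' i / al]. In
   the average of [q] the factor [f' i] cancels, which leaves the tilted law summed over distinct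
   points. *)
pose q k := law (sumz u v k) * rho (sumz u v k) * al / f' k.1.
have qpos k : 0 < prodw f' g' k -> 0 < q k.
  move=> h; rewrite divr_gt0 ?fpos // mulr_gt0 ?(alpos k) // mulr_gt0 ?lpos //.
have := gibbs a0 qpos.
have -> : \sum_k prodw f' g' k * log2 (q k) =
   \sum_k prodw f' g' k * log2 (law (sumz u v k))
   + \sum_k prodw f' g' k * log2 (rho (sumz u v k))
   + be * (ent f' - plogp al).
  have -> : be * (ent f' - plogp al) = \sum_k prodw f' g' k * (log2 al - log2 (f' k.1)).
    rewrite -(pair_bigA _ (fun i j => f' i * g' j * (log2 al - log2 (f' i)))) /=.
    transitivity (\sum_i (be * plogp (f' i) + be * log2 al * f' i)).
      by rewrite big_split /= -!mulr_sumr -/al /ent /plogp; ring.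
    apply: eq_bigr => i _.
    by rewrite -mulr_suml -mulr_sumr -/be /plogp; ring.
  rewrite -!big_split /=; apply: eq_bigr => k _.
  have := a0 k; rewrite le_eqVlt => /predU1P[<-|ak]; first by rewrite !mul0r !addr0.
  have F := fpos k ak; have A := alpos k ak; have L := lpos k ak.
  by rewrite /q log2_div ?log2M ?mulr_gt0 // -!mulrDr addrA.
rewrite mass_prodw -/al -/be.
have : \sum_k prodw f' g' k * q k <= al * be * E.
  rewrite -(pair_bigA _ (fun i j => f' i * g' j *
     (law (u i + v j) * rho (u i + v j) * al / f' i))) /= exchange_big /=.
  rewrite mulrAC mulrC /be mulr_suml; apply: ler_sum => j _.
  have vinj : injective (fun i => u i + v j) by move=> i i' /addIr /uinj.
  have H := pmass_inj_le (sumz u v) prodw_ge0 vinj (fun t => ltW (rho0 t)).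
  have Hj : 0 <= g' j * al by rewrite mulr_ge0 ?sumr_ge0.
  rewrite mulrA; apply: le_trans (ler_wpM2l Hj H); rewrite mulr_sumr.
  apply: ler_sum => i _.
  have : 0 <= g' j * al * (law (u i + v j) * rho (u i + v j)).
    by rewrite mulr_ge0 // mulr_ge0 // ?(ltW (rho0 _)) // pmass_ge0 //; exact: prodw_ge0.
  have [->|fi _] := eqVneq (f' i) 0; first by rewrite !mul0r.
  by rewrite le_eqVlt; apply/orP; left; apply/eqP; field.
have l2 : 0 <= (ln 2 : R)^-1 by rewrite invr_ge0 ltW // ln2_gt0.
move=> /(fun h => lerB h (lexx (al * be))) /(ler_wpM2r l2).
rewrite (_ : al * be * E - al * be = al * be * (E - 1)); last by ring.
lra.
Qed.

End Sum.

(* The entropy of u(x) + v(y) for independent x and y with laws f and g. *)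
Definition sent {R : realType} {G : zmodType} {I J : finType}
    (f : I -> R) (g : J -> R) (u : I -> G) (v : J -> G) : R :=
  pent (prodw f g) (sumz u v).

Lemma sum_swap {R : realType} {I J : finType} (F : J * I -> R) :
  \sum_(k : I * J) F (k.2, k.1) = \sum_k F k.
Proof.
rewrite (reindex (fun k : J * I => (k.2, k.1))) /=; first by apply: eq_bigr => -[].
by exists (fun k : I * J => (k.2, k.1)) => -[].
Qed.

Lemma pmass_swap {R : realType} {G : zmodType} {I J : finType}
    (f : I -> R) (g : J -> R) (u : I -> G) (v : J -> G) t :
  pmass (prodw g f) (sumz v u) t = pmass (prodw f g) (sumz u v) t.
Proof.
rewrite /pmass big_mkcond /= -sum_swap /= [RHS]big_mkcond /=.
by apply: eq_bigr => k _; rewrite /sumz /prodw /= addrC mulrC.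
Qed.

Lemma sent_swap {R : realType} {G : zmodType} {I J : finType}
    (f : I -> R) (g : J -> R) (u : I -> G) (v : J -> G) :
  sent g f v u = sent f g u v.
Proof.
rewrite /sent /pent -sum_swap /=; congr (- _); apply: eq_bigr => k _.
by rewrite pmass_swap /sumz /prodw /= addrC (mulrC (g _)).
Qed.

Definition prob {R : realType} {I : finType} (f : I -> R) : Prop :=
  (forall i, 0 <= f i) /\ \sum_i f i = 1.

Lemma prob_le1 {R : realType} {I : finType} (f : I -> R) i : prob f -> f i <= 1.
Proof. by move=> [f0 <-]; rewrite (bigD1 i) //= lerDl sumr_ge0. Qed.

Section Sum.
Context {R : realType} {G : zmodType} {I J : finType}.
Variables (f : I -> R) (g : J -> R) (u : I -> G) (v : J -> G).
Hypotheses (pf : prob f) (pg : prob g) (uinj : injective u) (vinj : injective v).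

Let f0 : forall i, 0 <= f i. Proof. by case: pf. Qed.
Let g0 : forall j, 0 <= g j. Proof. by case: pg. Qed.
Let f1 : \sum_i f i = 1. Proof. by case: pf. Qed.
Let g1 : \sum_j g j = 1. Proof. by case: pg. Qed.

Lemma ent_le_sent : ent f <= sent f g u v.
Proof.
have Hf i : 0 <= f i <= f i by rewrite f0 lexx.
have Hg j : 0 <= g j <= g j by rewrite g0 lexx.
have := cross_ge v f0 g0 uinj Hf Hg (fun=> ltr01).
rewrite f1 g1 log2_1 !mul1r -!mulr_suml mulr0 mulr1 mass_prodw f1 g1.
by rewrite mulr1 subrr mul0r subr0 addr0 /plogp log2_1 mulr0 oppr0 subr0.
Qed.

(** The pairs with [x] drawn from [f'] are charged to the entropy of [x] for given [y], the others
    to the entropy of [y] for given [x]. The part [f'] will be [f] without an atom in [atom_gain]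
    and a flat weight in [tail_gain]. *)
Lemma sent_ge_part (f' : I -> R) : (forall i, 0 <= f' i <= f i) ->
  ent f' - plogp (\sum_i f' i) + (1 - \sum_i f' i) * ent g <= sent f g u v.
Proof.
move=> Hf.
have Hg j : 0 <= g j <= g j by rewrite g0 lexx.
pose f'' i := f i - f' i.
have Hf'' i : 0 <= f'' i <= f i.
  by case/andP: (Hf i) => ? ?; rewrite /f'' subr_ge0 gerBl; apply/andP.
have r1 (t : G) : 0 < (1 : R) by [].
have := cross_ge v f0 g0 uinj Hf Hg r1.
have := cross_ge u g0 f0 vinj Hg Hf'' r1.
have m1 : \sum_k prodw f g k * 1 = 1 by rewrite -mulr_suml mass_prodw f1 g1 !mulr1.
have m2 : \sum_k prodw g f k * 1 = 1 by rewrite -mulr_suml mass_prodw f1 g1 !mulr1.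
rewrite m1 m2 !subrr !mulr0 !mul0r !log2_1 -!mulr_suml !mulr0 !addr0 g1 !subr0.
rewrite [in plogp 1]/plogp log2_1 mulr0 oppr0 subr0 mul1r.
have -> : \sum_i f'' i = 1 - \sum_i f' i by rewrite /f'' sumrB f1.
have -> : \sum_k prodw g f'' k * log2 (pmass (prodw g f) (sumz v u) (sumz v u k))
  = \sum_k prodw f'' g k * log2 (pmass (prodw f g) (sumz u v) (sumz u v k)).
  rewrite -sum_swap; apply: eq_bigr => k _ /=.
  by rewrite pmass_swap /sumz /prodw /= addrC (mulrC (g _)).
move=> H1 H2; apply: le_trans (lerD H2 H1) _.
rewrite /sent /pent -opprD -big_split /= le_eqVlt; apply/orP; left; apply/eqP.
congr (- _); apply: eq_bigr => k _; rewrite -mulrDl; congr (_ * _).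
by rewrite /prodw /f''; ring.
Qed.

End Sum.

(** * Ordered groups *)

Section Ordered.
Context {R : realType} {G : realDomainType}.

(* An atom at the median m is shared between the two halves f1 and f - f1. *)
Lemma median_split {I : finType} (f : I -> R) (u : I -> G) :
  prob f -> injective u ->
  exists m (f1 : I -> R), [/\ forall i, 0 <= f1 i <= f i, \sum_i f1 i = 1 / 2,
    forall i, 0 < f1 i -> u i <= m & forall i, f1 i < f i -> m <= u i].
Proof.
move=> [f0 fs] uinj.
pose F i := \sum_(j | u j <= u i) f j.
have [i0 _] : exists i : I, true.
  case: (pickP (@predT I)) => [i _|no]; first by exists i.
  by move: fs; rewrite big_pred0 // => /esym/eqP; rewrite oner_eq0.
have [im Pim] : exists i, 1 / 2 <= F i.
  case: (@Order.TotalTheory.arg_maxP _ _ I i0 predT u isT) => i _ Hi.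
  exists i; rewrite /F (eq_bigl predT) ?fs; first by lra.
  by move=> j; have /= -> := Hi j isT.
case: (@Order.TotalTheory.arg_minP _ _ I im (fun i => 1 / 2 <= F i) u Pim) => i1 Pi1 Hmin.
pose m := u i1; pose Fm := \sum_(j | u j < m) f j.
have FE : F i1 = Fm + f i1.
  rewrite /F (bigD1 i1) //= addrC; congr (_ + _); apply: eq_bigl => j.
  by rewrite lt_neqAle andbC (inj_eq uinj).
(* Otherwise the largest point below [m] would contradict the minimality of [i1]. *)
have Fm2 : Fm <= 1 / 2.
  case: (pickP (fun j => u j < m)) => [j0 Pj0|no]; last first.
    by rewrite /Fm big_pred0 //; lra.
  case: (@Order.TotalTheory.arg_maxP _ _ I j0 (fun j => u j < m) u Pj0) => j Pj Hj.
  rewrite leNgt; apply/negP => H.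
  suff : u i1 <= u j by rewrite leNgt Pj.
  apply: Hmin; rewrite /F (eq_bigl (fun k => u k < m)); first exact: ltW.
  move=> k; apply/idP/idP => [H1|]; first exact: (le_lt_trans H1).
  by move=> /Hj.
exists m, (fun i => if u i < m then f i else if u i == m then 1 / 2 - Fm else 0).
split.
- move=> i; case: ifP => _; first by rewrite f0 lexx.
  case: eqP => [/uinj ->|_]; last by rewrite lexx f0.
  by rewrite FE in Pi1; apply/andP; split; lra.
- rewrite (bigID (fun i => u i < m)) /= (eq_bigr f); last by move=> i ->.
  rewrite -/Fm (bigD1 i1) ?ltxx //= eqxx big1; first by ring.
  by move=> i /andP[/negbTE -> /negbTE]; rewrite (inj_eq uinj) => ->.
- by move=> i; case: (ltP (u i) m) => [/ltW //|_] /=; case: ifP => [/eqP -> //|_]; rewrite ltxx.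
- by move=> i; case: (ltP (u i) m) => // _; rewrite ltxx.
Qed.

(* Given the sign of z - (m + n), tilt the law of the sum by 3/2 towards the half
   predicted by this sign and by 1/2 towards the other one.  The error term
   bounds the mass of z = m + n coming from the upper halves. *)
Lemma ordered_gain {I J : finType} (f : I -> R) (g : J -> R) (u : I -> G) (v : J -> G) d :
  prob f -> prob g -> injective u -> injective v ->
  (forall i, f i <= d) -> (forall j, g j <= d) ->
  (ent f + ent g) / 2 + 3 / 4 * log2 3 - 1 - d ^+ 2 * log2 3 <= sent f g u v.
Proof.
move=> pf pg uinj vinj fd gd.
have [f0 fs] := pf; have [g0 gs] := pg.
have [m [f1 [f1f f1s f1l f1r]]] := median_split pf uinj.
have [n [g1 [g1g g1s g1l g1r]]] := median_split pg vinj.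
pose f2 i := f i - f1 i; pose g2 i := g i - g1 i.
have f2f i : 0 <= f2 i <= f i.
  by case/andP: (f1f i) => ? ?; rewrite /f2 subr_ge0 gerBl; apply/andP.
have g2g i : 0 <= g2 i <= g i.
  by case/andP: (g1g i) => ? ?; rewrite /g2 subr_ge0 gerBl; apply/andP.
have f2s : \sum_i f2 i = 1 / 2 by rewrite sumrB fs f1s; field.
have g2s : \sum_i g2 i = 1 / 2 by rewrite sumrB gs g1s; field.
pose e (z : G) : R := (z <= m + n)%R%:R.
pose r1 (z : G) : R := if z <= m + n then 3 / 2 else 1 / 2.
pose r2 (z : G) : R := if z <= m + n then 1 / 2 else 3 / 2.
have r10 z : 0 < r1 z by rewrite /r1; case: ifP => _; lra.
have r20 z : 0 < r2 z by rewrite /r2; case: ifP => _; lra.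
have lh : log2 (1 / 2) = -1 :> R.
  by rewrite mul1r log2V // (log2_pow2 1).
have l3 : log2 (3 / 2) = log2 3 - 1 :> R.
  by rewrite log2_div // (log2_pow2 1).
have lr1 z : log2 (r1 z) = log2 3 * e z - 1.
  by rewrite /r1 /e; case: ifP => _; rewrite ?lh ?l3 /=; ring.
have lr2 z : log2 (r2 z) = log2 3 * (1 - e z) - 1.
  by rewrite /r2 /e; case: ifP => _; rewrite ?lh ?l3 /=; ring.
have r12 z : r2 z = 2 - r1 z by rewrite /r1 /r2; case: ifP => _; field.
have p1 : plogp 1 = 0 :> R by rewrite /plogp log2_1 mulr0 oppr0.
have key (I' J' : finType) (F : I' -> R) (H : J' -> R) (u' : I' -> G) (v' : J' -> G) H1 H2 :
   prob F -> prob H -> injective u' ->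
   (forall j, 0 <= H1 j <= H j) -> (forall j, 0 <= H2 j <= H j) ->
   (forall j, H1 j + H2 j = H j) -> \sum_j H1 j = 1 / 2 -> \sum_j H2 j = 1 / 2 ->
   ent F - 1 + log2 3 * (\sum_k F k.1 * (H1 k.2 * e (sumz u' v' k) + H2 k.2 * (1 - e (sumz u' v' k))))
     <= sent F H u' v'.
  move=> [F0 Fs] [H0 Hs] u'inj H1H H2H H12 H1s H2s.
  have FF i : 0 <= F i <= F i by rewrite F0 lexx.
  have A1 := cross_ge v' F0 H0 u'inj FF H1H r10.
  have A2 := cross_ge v' F0 H0 u'inj FF H2H r20.
  have := lerD A1 A2.
  rewrite Fs H1s H2s p1 !subr0 !mul1r.
  (* As [r1 + r2 = 2] and both halves have mass 1/2, the normalization errors of the two uses of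
     [cross_ge] cancel. *)
  have ER : \sum_k prodw F H k * r2 (sumz u' v' k)
      = 2 - \sum_k prodw F H k * r1 (sumz u' v' k).
    under eq_bigr do rewrite r12 mulrBr.
    by rewrite sumrB -mulr_suml mass_prodw Fs Hs !mul1r.
  rewrite ER.
  have -> : sent F H u' v' = - (\sum_k prodw F H1 k *
         log2 (pmass (prodw F H) (sumz u' v') (sumz u' v' k))) -
      \sum_k prodw F H2 k * log2 (pmass (prodw F H) (sumz u' v') (sumz u' v' k)).
    rewrite /sent /pent -opprD -big_split /=; congr (- _); apply: eq_bigr => k _.
    by rewrite -mulrDl /prodw -H12 -mulrDr.
  have -> : \sum_k F k.1 * (H1 k.2 * e (sumz u' v' k) + H2 k.2 * (1 - e (sumz u' v' k)))
    = \sum_k prodw F H1 k * e (sumz u' v' k) + \sum_k prodw F H2 k * (1 - e (sumz u' v' k)).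
    by rewrite -big_split /=; apply: eq_bigr => k _; rewrite /prodw; ring.
  have -> : \sum_k prodw F H1 k * log2 (r1 (sumz u' v' k))
    = log2 3 * \sum_k prodw F H1 k * e (sumz u' v' k) - 1 / 2.
    have <- : \sum_k prodw F H1 k = 1 / 2 by rewrite mass_prodw Fs H1s mul1r.
    by rewrite mulr_sumr -sumrB; apply: eq_bigr => k _; rewrite lr1; ring.
  have -> : \sum_k prodw F H2 k * log2 (r2 (sumz u' v' k))
    = log2 3 * \sum_k prodw F H2 k * (1 - e (sumz u' v' k)) - 1 / 2.
    have <- : \sum_k prodw F H2 k = 1 / 2 by rewrite mass_prodw Fs H2s mul1r.
    by rewrite mulr_sumr -sumrB; apply: eq_bigr => k _; rewrite lr2; ring.
  lra.
have K1 := key I J f g u v g1 g2 pf pg uinj g1g g2g (fun j => subrKC _ _) g1s g2s.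
have K2 := key J I g f v u f1 f2 pg pf vinj f1f f2f (fun j => subrKC _ _) f1s f2s.
rewrite sent_swap -sum_swap /= in K2.
have := lerD K1 K2.
set Q1 := \sum_k _; set Q2 := \sum_k _ => K12.
(* [Q1] and [Q2] are the probabilities that the sign predicts the half of [y] and of [x]. A pair
   from opposite halves gives exactly one success, and a pair from equal halves gives two, except
   for upper pairs with sum [m + n]. Without this exception the total is 1/4 + 1/4 + 2 (1/4 + 1/4) =
   3/2. *)
have Q12 : 3 / 2 - 2 * d ^+ 2 <= Q1 + Q2; last first.
  have l30 : 0 <= log2 3 :> R by have := @log2_3_ge R; lra.
  have := ler_wpM2l l30 Q12; lra.
pose t (k : I * J) : R := (u k.1 == m)%:R * f k.1 * ((v k.2 == n)%:R * g k.2).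
have T : \sum_k t k <= d ^+ 2.
  rewrite /t -(pair_bigA _ (fun i j => (u i == m)%:R * f i * ((v j == n)%:R * g j))) /=.
  under eq_bigr do rewrite -mulr_sumr.
  rewrite -mulr_suml expr2.
  have at_most (I' : finType) (w : I' -> G) c (h : I' -> R) : injective w ->
     (forall i, 0 <= h i) -> (forall i, h i <= d) -> prob h ->
     0 <= \sum_i (w i == c)%:R * h i <= d.
    move=> winj h0 hd [_ hs]; rewrite sumr_ge0 /=; last by move=> i _; rewrite mulr_ge0.
    have d0 : 0 <= d.
      case: (pickP (@predT I')) => [i _|no]; first exact: le_trans (h0 i) (hd i).
      by move: hs; rewrite big_pred0 // => /esym/eqP; rewrite oner_eq0.
    case: (pickP (fun i => w i == c)) => [i /eqP wi|no]; last first.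
      by rewrite big1 // => i _; rewrite no mul0r.
    rewrite (bigD1 i) //= wi eqxx mul1r big1 ?addr0 // => j ji.
    by rewrite -wi (inj_eq winj) (negbTE ji) mul0r.
  have /andP[? ?] := at_most _ u m f uinj f0 fd pf.
  have /andP[? ?] := at_most _ v n g vinj g0 gd pg.
  exact: ler_pM.
have -> : Q1 + Q2 = \sum_k (prodw f1 g2 k + prodw f2 g1 k
   + 2 * (e (sumz u v k) * prodw f1 g1 k + (1 - e (sumz u v k)) * prodw f2 g2 k)).
  rewrite -big_split /=; apply: eq_bigr => k _.
  rewrite (_ : sumz v u (k.2, k.1) = sumz u v k); last by rewrite /sumz /= addrC.
  by rewrite /prodw /f2 /g2; ring.
have : \sum_k (prodw f1 g2 k + prodw f2 g1 k
   + 2 * (prodw f1 g1 k + prodw f2 g2 k - t k)) <= \sum_k (prodw f1 g2 k + prodw f2 g1 k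
   + 2 * (e (sumz u v k) * prodw f1 g1 k + (1 - e (sumz u v k)) * prodw f2 g2 k)).
  apply: ler_sum => k _; rewrite lerD2l ler_pM2l //.
  have /andP[f10 _] := f1f k.1; have /andP[g10 _] := g1g k.2.
  have /andP[f20 f2le] := f2f k.1; have /andP[g20 g2le] := g2g k.2.
  have t0 : 0 <= t k by rewrite /t !mulr_ge0.
  rewrite /e; case: (leP (sumz u v k) (m + n)) => /= h.
    rewrite mul1r subrr mul0r addr0.
    suff : prodw f2 g2 k <= t k by lra.
    rewrite /prodw.
    have [->|f2n] := eqVneq (f2 k.1) 0; first by rewrite mul0r.
    have [->|g2n] := eqVneq (g2 k.2) 0; first by rewrite mulr0.
    have hu : m <= u k.1 by apply: f1r; rewrite -subr_gt0 lt_def f2n.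
    have hv : n <= v k.2 by apply: g1r; rewrite -subr_gt0 lt_def g2n.
    have Eu : u k.1 = m.
      by apply/eqP; rewrite eq_le hu andbT -(lerD2r n) (le_trans _ h) // /sumz lerD2l.
    have Ev : v k.2 = n.
      by apply/eqP; rewrite eq_le hv andbT -(lerD2l m) (le_trans _ h) // /sumz lerD2r.
    by rewrite /t Eu Ev !eqxx !mul1r; apply: ler_pM.
  rewrite mul0r subr0 mul1r add0r.
  suff -> : prodw f1 g1 k = 0 by lra.
  rewrite /prodw; have [->|f1n] := eqVneq (f1 k.1) 0; first by rewrite mul0r.
  have [->|g1n] := eqVneq (g1 k.2) 0; first by rewrite mulr0.
  have hu : u k.1 <= m by apply: f1l; rewrite lt_def f1n.
  have hv : v k.2 <= n by apply: g1l; rewrite lt_def g1n.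
  by move: h; rewrite ltNge lerD.
rewrite !big_split /= -!mulr_sumr !big_split /= sumrN !mass_prodw f1s g1s f2s g2s.
move: T; lra.
Qed.

End Ordered.

(** * Large atoms and unequal entropies *)

Section Reduce.
Context {R : realType} {G : zmodType} {I J : finType}.
Variables (f : I -> R) (g : J -> R) (u : I -> G) (v : J -> G).
Hypotheses (pf : prob f) (pg : prob g) (uinj : injective u) (vinj : injective v).

(** On the event that X is the atom, X + Y is a translate of Y and contributes [f i * ent g].
    Removing the atom from [f] costs two values of [plogp], each at most 2. *)
Lemma atom_gain i : ent f + f i * ent g - 4 <= sent f g u v.
Proof.
have [f0 fs] := pf; have fi1 := prob_le1 i pf.
pose f' k := if k == i then 0 else f k.
have f'f k : 0 <= f' k <= f k by rewrite /f'; case: ifP => _; rewrite ?lexx f0.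
have := sent_ge_part pf pg uinj vinj f'f.
have -> : \sum_k f' k = 1 - f i.
  have := fs; rewrite (bigD1 i) //= => <-; rewrite (bigD1 i) //= /f' eqxx.
  rewrite add0r [RHS]addrC addKr; by apply: eq_bigr => k /negbTE ->.
have -> : ent f' = ent f - plogp (f i).
  rewrite /ent [in RHS](bigD1 i) //= [RHS]addrC addKr (bigD1 i) //= /f' eqxx plogp0 add0r.
  by apply: eq_bigr => k /negbTE ->.
have := plogp_le2 (f0 i) fi1.
have : plogp (1 - f i) <= 2 by apply: plogp_le2; have := f0 i; lra.
lra.
Qed.

End Reduce.

(** If the entropies differ by more than 1/4, the larger one exceeds the mean by 1/8. Otherwise both
    are at least 10900, and an atom above 2^-11 gains at least 10900 / 2048 - 4 > 1/4 by
    [atom_gain]; the bound 11000 on the entropy is made for this. *)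
Lemma gain_reduce {R : realType} {G : zmodType} {I J : finType}
    (f : I -> R) (g : J -> R) (u : I -> G) (v : J -> G) :
  prob f -> prob g -> injective u -> injective v -> 110 * 100 <= ent f ->
  (ent f <= ent g + 1 / 4 -> ent g <= ent f + 1 / 4 ->
   (forall i, f i <= 2 ^- 11) -> (forall j, g j <= 2 ^- 11) ->
   (ent f + ent g) / 2 + 1 / 8 <= sent f g u v) ->
  (ent f + ent g) / 2 + 1 / 8 <= sent f g u v.
Proof.
move=> pf pg uinj vinj hf H.
have Hf := ent_le_sent v pf pg uinj.
have Hg := ent_le_sent u pg pf vinj; rewrite sent_swap in Hg.
have [/ltW h1|h1] := ltP (ent g + 1 / 4) (ent f); first by lra.
have [/ltW h2|h2] := ltP (ent f + 1 / 4) (ent g); first by lra.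
have e11 : (2 : R) ^- 11 = 1 / 2048 by rewrite -natrX mul1r; congr (_ ^-1).
case: (pickP (fun i => 2 ^- 11 < f i)) => [i|nf].
  rewrite e11 => big; have A := atom_gain pf pg uinj vinj i.
  have : 1 / 2048 * (109 * 100 : R) <= f i * ent g by apply: ler_pM; lra.
  lra.
case: (pickP (fun j => 2 ^- 11 < g j)) => [j|ng].
  rewrite e11 => big; have A := atom_gain pg pf vinj uinj j; rewrite sent_swap in A.
  have : 1 / 2048 * (109 * 100 : R) <= g j * ent f by apply: ler_pM; lra.
  lra.
by apply: H => // [i|j]; rewrite leNgt ?nf ?ng.
Qed.

Lemma finite_ordered_gain {R : realType} {G : realDomainType} {I J : finType}
    (f : I -> R) (g : J -> R) (u : I -> G) (v : J -> G) :
  prob f -> prob g -> injective u -> injective v -> 110 * 100 <= ent f ->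
  (ent f + ent g) / 2 + 1 / 8 <= sent f g u v.
Proof.
move=> pf pg uinj vinj hf; apply: gain_reduce => // _ _ fd gd.
have := ordered_gain pf pg uinj vinj fd gd.
have e11 : (2 : R) ^- 11 = 1 / 2048 by rewrite -natrX mul1r; congr (_ ^-1).
rewrite e11; have := @log2_3_ge R; have := @log2_3_le2 R.
set l := log2 3; lra.
Qed.

(** * Rearrangement on the integers *)

(* 0, 1, -1, 2, -2, and so on: every initial segment is an interval. *)
Definition zigzag (n : nat) : int := if odd n then n./2.+1%:Z else - n./2%:Z.

Lemma zigzag_inj : injective zigzag.
Proof. move=> m n; rewrite /zigzag; case: ifP => om; case: ifP => on; lia. Qed.

Lemma absz_zigzag n : `|zigzag n|%N = uphalf n.
Proof. by rewrite /zigzag; case: ifP => on; lia. Qed.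

Lemma zigzag_surj (x : int) : exists2 n, (n <= `|x|.*2)%N & zigzag n = x.
Proof.
have [x0|x0] := lerP x 0.
  exists `|x|.*2 => //; rewrite /zigzag; case: ifP => on; lia.
exists `|x|.*2.-1; first by lia.
rewrite /zigzag; case: ifP => on; lia.
Qed.

(** Positions with indices of equal parity lie on the same side of 0. *)
Lemma zigzag_dist i j : `|zigzag i - zigzag j|%N =
  if odd i == odd j then (maxn i j - minn i j)./2 else (i + j).+1./2.
Proof. rewrite /zigzag; case: ifP => oi; case: ifP => oj /=; lia. Qed.

(** Differences occur because the second law is reflected: a prefix of even length is an interval
    centred at 1/2, and the reflection moves the sum of two such intervals back to centre 0. *)
Definition far (h i j : nat) : nat := \sum_(m < i) \sum_(n < j) (h < `|zigzag m - zigzag n|)%N.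

(** As [j <= i], [zigzag i] lies outside the interval of the first [j] positions. Its distances to
    them are therefore distinct, and they are at most [(i + j)./2]. *)
Lemma far_row h i j : (j <= i)%N ->
  (\sum_(n < j) (h < `|zigzag i - zigzag n|)%N <= minn j ((i + j)./2 - h))%N.
Proof.
elim: j => [|j IH] ji; first by rewrite big_ord0.
rewrite big_ord_recr /= zigzag_dist; have := IH (ltnW ji).

set s := (\sum_(n < j) _)%N; move=> Hs.
have [d [b Ed]] : exists d (b : bool), i = (j + d.*2 + b)%N.
  by exists (i - j)./2, (odd (i - j)); have := odd_double_half (i - j); lia.
have oE : (odd i == odd j) = ~~ b.
  by rewrite Ed !oddD odd_double addbF; case: (odd j) (b) => -[].
rewrite oE; move: Hs; move: s => s; rewrite Ed; clear; case: b => /=.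
  rewrite (_ : j + d.*2 + 1 + j = (j + d).*2.+1)%N; last by lia.
  rewrite (_ : j + d.*2 + 1 + j.+1 = (j + d).+1.*2)%N; last by lia.
  rewrite (_ : uphalf (j + d).*2.+1 = (j + d).+1); last by rewrite /= doubleK.
  rewrite doubleK /= uphalf_double; case: ltnP => /= hd; lia.
rewrite addn0 (_ : maxn _ j - minn _ j = d.*2)%N; last by lia.
rewrite doubleK.
rewrite (_ : j + d.*2 + j = (j + d).*2)%N; last by lia.
rewrite (_ : j + d.*2 + j.+1 = (j + d).*2.+1)%N; last by lia.
rewrite doubleK /= uphalf_double; case: ltnP => /= hd; lia.
Qed.

Lemma farC h i j : far h i j = far h j i.
Proof.
rewrite /far exchange_big /=; apply: eq_bigr => n _; apply: eq_bigr => m _.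
by rewrite -abszN opprB.
Qed.

Lemma far_recl h i j : far h i.+1 j = (far h i j + \sum_(n < j) (h < `|zigzag i - zigzag n|)%N)%N.
Proof. by rewrite /far big_ord_recr. Qed.

(** With c = i + j - 2h - 1, the bound is the maximum of t (c - t) over t <= j, which is the form
    that [far_bound] needs. Rows are added to the square case [diag], since [far_row] covers only
    [j <= i]. *)
Lemma far_bound_le h i j : (j <= i)%N ->
  (far h i j <= minn j ((i + j - h.*2.+1)./2) * (i + j - h.*2.+1 - minn j ((i + j - h.*2.+1)./2)))%N.
Proof.
have diag k : (far h k k <= (k - h) * (k - h).-1)%N.
  elim: k => [|k IH]; first by rewrite /far big_ord0.
  rewrite far_recl farC far_recl big_ord_recr /= subrr.
  have := far_row h (leqnn k); rewrite addnn doubleK.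
  set r := (\sum_(n < k) _)%N => Hr.
  have : (r <= k - h)%N by lia.
  case: (leqP k h) => kh.
    rewrite (_ : k - h = 0)%N in IH *; last by lia.
    lia.
  rewrite subSn ?(ltnW kh) //; nia.
elim: i => [|i IH]; first by rewrite leqn0 => /eqP ->; rewrite /far big_ord0.
rewrite leq_eqVlt => /predU1P[->|ji].
  apply: leq_trans (diag _) _; rewrite addnn.
  case: (leqP i.+1 h) => ih; first by rewrite (_ : i.+1 - h = 0)%N //; lia.
  rewrite (_ : minn _ _ = (i.+1 - h).-1); last by lia.
  rewrite (_ : (_ - _ - _ = i.+1 - h)%N); last by lia.
  by rewrite mulnC.
rewrite far_recl; have := IH ji; have := @far_row h i j ji.
move: (\sum_(n < j) _)%N (far h i j) => r F; move: ji; clear.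
case: (leqP (i + j).+1 h.*2.+1) => c0 ji rle.
  have -> : r = 0%N by lia.
  rewrite (_ : i + j - h.*2.+1 = 0)%N ?minn0 ?mul0n; last by lia.
  by rewrite leqn0 => /eqP ->.
have [c Ec] : exists c, (i + j = h.*2 + c.+1)%N by exists (i + j - h.*2 - 1)%N; lia.
rewrite addSn (_ : ((i + j).+1 - h.*2.+1 = c.+1)%N); last by lia.
rewrite (_ : (i + j - h.*2.+1 = c)%N); last by lia.
move: rle; rewrite (_ : ((i + j)./2 - h = c.+1./2)%N); last by lia.
have cj : (j.*2 <= h.*2 + c.+1)%N by lia.
move: cj; clear => cj rle.
have [m [b Ec]] : exists m (b : bool), c = (b + m.*2)%N.
  by exists c./2, (odd c); rewrite odd_double_half.
have h1 : c./2 = m by rewrite Ec half_bit_double.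
have h2 : c.+1./2 = (b + m)%N by rewrite Ec; case: (b) => /=; rewrite ?doubleK ?uphalf_double.
rewrite h1; move: rle; rewrite h2 => rle.
case: (leqP j m) => jc.
  have -> : minn j (b + m) = j by lia.
  move=> FH.
  have [e Ee] : exists e, (c = j + e)%N by exists (c - j)%N; lia.
  by move: FH; rewrite Ee -addnS !addKn; nia.
have jm' : minn j (b + m) = (b + m)%N by apply/minn_idPr; case: (b); lia.
rewrite jm' => FH; rewrite jm' in rle.
move: FH; rewrite Ec (_ : b + m.*2 - m = b + m)%N; last by lia.
rewrite (_ : (b + m.*2).+1 - (b + m) = m.+1)%N; last by lia.
by move: rle; case: (b) => /=; nia.
Qed.

(* The value of t makes the bound of sum_nrep_le match the number of pairs
   (zigzag m, - zigzag n) whose sum lies in [-h, h]. *)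
Lemma far_bound h i j : exists t, [/\ (t <= i)%N, (t <= j)%N &
  (far h i j + t * (t + h.*2.+1) <= t * (i + j))%N].
Proof.
wlog ji : i j / (j <= i)%N.
  move=> W; have [/W //|/ltnW /W [t [? ? ?]]] := leqP j i.
  by exists t; rewrite farC [(i + j)%N]addnC.
have := far_bound_le h ji.
case: (leqP h.*2.+1 (i + j)) => c0; last first.
  rewrite (_ : (i + j - _ = 0)%N) /= ?minn0 ?mul0n; last by lia.
  by move=> h0; exists 0%N; rewrite !mul0n addn0.
set t := minn j _ => H; exists t; split; [lia|lia|].
have [c Ec] : exists c, (i + j = h.*2.+1 + t + c)%N by exists (i + j - h.*2.+1 - t)%N; lia.
move: H; rewrite Ec (_ : (_ + _ + _ - _ - _ = c)%N); last by lia.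
nia.
Qed.

(** * Summation by parts *)

Section Abel.
Context {R : realType}.

(** The induction needs the stronger lower bound [F n] times the full sum of [c]. *)
Lemma abel_ge0 (F c : nat -> R) n : (forall m, 0 <= F m) -> (forall m, F m.+1 <= F m) ->
  (forall k, (k <= n)%N -> 0 <= \sum_(m < k) c m) -> 0 <= \sum_(m < n) F m * c m.
Proof.
move=> F0 Fd; have key : (forall k, (k <= n)%N -> 0 <= \sum_(m < k) c m) ->
   F n * \sum_(m < n) c m <= \sum_(m < n) F m * c m.
  elim: n => [|n IH] H; first by rewrite !big_ord0 mulr0.
  have {}IH := IH (fun k kn => H k (leqW kn)).
  rewrite !big_ord_recr /=.
  have := H n.+1 (leqnn _); rewrite big_ord_recr /= => H1.
  have := ler_wpM2r H1 (Fd n); have := ler_wpM2r (H n (leqnSn n)) (Fd n).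
  lra.
by move=> H; apply: le_trans (key H); rewrite mulr_ge0 // H.
Qed.

Lemma abel2_ge0 (F F' : nat -> R) (D : nat -> nat -> R) n :
  (forall m, 0 <= F m) -> (forall m, F m.+1 <= F m) ->
  (forall m, 0 <= F' m) -> (forall m, F' m.+1 <= F' m) ->
  (forall i j, (i <= n)%N -> (j <= n)%N -> 0 <= \sum_(m < i) \sum_(l < j) D m l) ->
  0 <= \sum_(m < n) \sum_(l < n) F m * F' l * D m l.
Proof.
move=> F0 Fd F'0 F'd H.
under eq_bigr do under eq_bigr do rewrite -mulrA.
under eq_bigr do rewrite -mulr_sumr.
apply: (abel_ge0 (c := fun m => \sum_(l < n) F' l * D m l)) => // i iL.
rewrite exchange_big /=; under eq_bigr do rewrite -mulr_sumr.
apply: (abel_ge0 (c := fun l => \sum_(m < i) D m l)) => // j jL.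
by rewrite exchange_big /= H.
Qed.

(** The entries whose index [zigzag] sends to h or -h, that is, those with [uphalf m = h]. *)
Definition block (Z : nat -> R) (h : nat) : R :=
  if h is h'.+1 then Z h'.*2.+1 + Z h'.*2.+2 else Z 0%N.

Lemma sum_uphalf (Z F : nat -> R) M :
  \sum_(m < M.*2.+1) Z m * F (uphalf m) =
  \sum_(h < M.+1) F h * block Z h.
Proof.
elim: M => [|M IH]; first by rewrite !big_ord_recr !big_ord0 /= mulrC.
rewrite doubleS big_ord_recr big_ord_recr /= IH [in RHS]big_ord_recr /= -addrA.
by congr (_ + _); rewrite /block uphalf_double /= doubleK; ring.
Qed.

Lemma abel_blocks (Z om F : nat -> R) M :
  (forall m, 0 <= F m) -> (forall m, F m.+1 <= F m) ->
  (forall H, (H <= M)%N -> \sum_(m < H.*2.+1) Z m <= \sum_(h < H.+1) om h) ->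
  \sum_(m < M.*2.+1) Z m * F (uphalf m) <= \sum_(h < M.+1) F h * om h.
Proof.
move=> F0 Fd H; rewrite sum_uphalf -subr_ge0 -sumrB.
under eq_bigr do rewrite -mulrBr.
apply: (abel_ge0 (c := fun h => om h - block Z h)) => // -[|k] kM; first by rewrite big_ord0.
rewrite sumrB subr_ge0; apply: le_trans (H k kM).
have := sum_uphalf Z (fun=> 1) k.
under eq_bigr do rewrite mulr1.
by under [RHS]eq_bigr do rewrite mul1r; move=> ->.
Qed.

End Abel.

(** * Decreasing rearrangements *)

Definition ranking {R : realType} {T : finType} (f : T -> R) (s : seq T) : Prop :=
  [/\ uniq s, forall x, x \in s & sorted (fun x y => f y <= f x) s].

Section Ranking.
Context {R : realType} {T : finType}.
Implicit Types (f : T -> R) (s : seq T).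

Lemma ranking_exists f : exists s, ranking f s.
Proof.
exists (sort (fun x y => f y <= f x) (enum T)); split.
- by rewrite sort_uniq enum_uniq.
- by move=> x; rewrite mem_sort mem_enum.
- by apply: sort_sorted => x y; exact: le_total.
Qed.

(** The default value 0 past the end keeps the sequence nonnegative and decreasing on all of [nat],
    as Abel summation requires. *)
Definition ranked f s (m : nat) : R := (map f s)`_m.

Variables (f : T -> R) (s : seq T).
Hypotheses (rs : ranking f s).

Lemma ranking_perm : perm_eq (index_enum T) s.
Proof.
have [us ms _] := rs; apply: uniq_perm => //; first exact: index_enum_uniq.
by move=> x; rewrite ms mem_index_enum.
Qed.

Lemma ranking_size : size s = #|T|.
Proof. by rewrite -(perm_size ranking_perm) cardT enumT. Qed.

Lemma ranked_index x : ranked f s (index x s) = f x.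
Proof.
have [_ ms _] := rs.
by rewrite /ranked (nth_map x) ?index_mem ?ms // nth_index ?ms.
Qed.

Lemma ranked_default m : (#|T| <= m)%N -> ranked f s m = 0.
Proof. by move=> h; rewrite /ranked nth_default // size_map ranking_size. Qed.

Lemma sum_ranked x0 (H : T -> R) :
  \sum_x f x * H x = \sum_(m < #|T|) ranked f s m * H (nth x0 s m).
Proof.
rewrite (perm_big _ ranking_perm) /= (big_nth x0) ranking_size big_mkord.
by apply: eq_bigr => m _; rewrite /ranked (nth_map x0) // ranking_size.
Qed.

Hypothesis f0 : forall x, 0 <= f x.

Lemma ranked_ge0 m : 0 <= ranked f s m.
Proof.
have [h|h] := ltnP m #|T|; last by rewrite ranked_default.
have x0 : T by case: (s) ranking_size h => [<-//|x]; rewrite ?ltn0.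
by rewrite /ranked (nth_map x0) // ranking_size.
Qed.

Lemma ranked_leS m : ranked f s m.+1 <= ranked f s m.
Proof.
have [h|h] := ltnP m.+1 #|T|; last by rewrite ranked_default // ranked_ge0.
have [_ _ ss] := rs.
have x0 : T by case: (s) ranking_size h => [<-//|x]; rewrite ?ltn0.
have := ss => /(sortedP x0)/(_ m); rewrite ranking_size => /(_ h).
by rewrite /ranked !(nth_map x0) ?ranking_size // ltnW.
Qed.

Lemma ranked_le m n : (m <= n)%N -> ranked f s n <= ranked f s m.
Proof.
elim: n => [|n IH]; first by rewrite leqn0 => /eqP ->.
by rewrite leq_eqVlt => /predU1P[->//|/IH]; apply: le_trans; exact: ranked_leS.
Qed.

End Ranking.

Lemma big_take_nth {V T : Type} {idx : V} {op : V -> V -> V} (x0 : T) (s : seq T)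
    (H : T -> V) i : (i <= size s)%N ->
  \big[op/idx]_(x <- take i s) H x = \big[op/idx]_(m < i) H (nth x0 s m).
Proof.
move=> si; rewrite (big_nth x0) size_takel // big_mkord.
by apply: eq_bigr => m _; rewrite nth_take.
Qed.

Section Rearrange.
Context {R : realType} {G : finZmodType}.
Variables (f g : G -> R) (a b : seq G) (L : nat).
Hypotheses (np : @no_period G) (pf : prob f) (pg : prob g).
Hypotheses (fa : ranking f a) (gb : ranking g b).
Hypotheses (LG : (L + L <= #|G|)%N).
Hypotheses (fL : forall m, (L <= m)%N -> ranked f a m = 0).
Hypotheses (gL : forall m, (L <= m)%N -> ranked g b m = 0).

Let f0 : forall x, 0 <= f x. Proof. by case: pf. Qed.
Let g0 : forall x, 0 <= g x. Proof. by case: pg. Qed.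

Definition rankz (s : seq G) (x : G) : int := zigzag (index x s).

Lemma rankz_inj (h : G -> R) s : ranking h s -> injective (rankz s).
Proof.
move=> [_ ms _] x y /zigzag_inj /(congr1 (nth x s)).
by rewrite !nth_index ?ms.
Qed.

Local Notation law := (pmass (prodw f g) (sumz id id)).
Local Notation u := (rankz a).
Local Notation v := (fun y => - rankz b y).

Lemma card_prefix (s : seq G) i : uniq s -> (i <= size s)%N ->
  #|[set x in take i s]| = i.
Proof. by move=> us si; rewrite cardsE (card_uniqP (take_uniq i us)) size_takel. Qed.

Lemma sum_prefix (s : seq G) i (H : G -> nat) : uniq s -> (i <= size s)%N ->
  (\sum_(x in [set x in take i s]) H x)%N = (\sum_(m < i) H (nth 0%R s m))%N.
Proof.
move=> us si; rewrite (eq_bigl (mem (take i s))); last by move=> x; rewrite inE.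
by rewrite -(big_uniq _ (take_uniq i us)) (big_take_nth (0 : G)).
Qed.

(** The case of uniform weights on the prefixes [A] and [B]: [sum_nrep_le] with the [t] of
    [far_bound]. The bound by [L] on both prefixes ensures the size condition of Pollard's
    theorem. *)
Lemma rectangle_le (S : {set G}) h i j : (#|S| <= h.*2.+1)%N -> (i <= L)%N -> (j <= L)%N ->
  (\sum_(m < i) \sum_(n < j) ((nth 0 a m + nth 0 b n)%R \in S) + far h i j <= i * j)%N.
Proof.
move=> Sh iL jL; have [ua _ _] := fa; have [ub _ _] := gb.
have sa : (i <= size a)%N by rewrite (ranking_size fa) (leq_trans iL) // (leq_trans _ LG) ?leq_addr.
have sb : (j <= size b)%N by rewrite (ranking_size gb) (leq_trans jL) // (leq_trans _ LG) ?leq_addr.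
pose A : {set G} := [set x in take i a]; pose B : {set G} := [set x in take j b].
have cA : #|A| = i by apply: card_prefix.
have cB : #|B| = j by apply: card_prefix.
have -> : (\sum_(m < i) \sum_(n < j) ((nth 0 a m + nth 0 b n)%R \in S) = \sum_(x in S) nrep A B x)%N.
  rewrite /nrep [RHS]exchange_big /= /A (sum_prefix _ ua sa); apply: eq_bigr => m _.
  rewrite [RHS]exchange_big /= /B (sum_prefix _ ub sb); apply: eq_bigr => n _.
  set y := (_ + _)%R; case: (boolP (y \in S)) => yS.
    rewrite (bigD1 y) //= eqxx big1 // => x /andP[_]; by rewrite eq_sym => /negbTE ->.
  by rewrite big1 // => x xS; case: eqP => // yx; rewrite yx xS in yS.
have [t [ti tj]] := far_bound h i j.
have ABG : (#|A| + #|B| <= #|G|)%N by rewrite cA cB (leq_trans _ LG) // leq_add.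
have := @sum_nrep_le G A B S t np ABG; rewrite cA cB => /(_ ti tj).
set X := (\sum_(x in S) _)%N; set F := far h i j => H1 H2.
have H3 : (t * #|S| <= t * h.*2.+1)%N by rewrite leq_mul2l Sh orbT.
have [d Ed] : exists d, (i + j = t + d)%N by exists (i + j - t)%N; lia.
move: H1 H2; rewrite Ed addKn; nia.
Qed.

(** The weights decrease with the rank, so one Abel summation in each variable reduces the claim to
    prefixes, that is, to [rectangle_le]. Ranks from [L] on carry no mass and are dropped first. *)
Lemma top_mass_le (S : {set G}) h : (#|S| <= h.*2.+1)%N ->
  \sum_(x in S) law x <= \sum_k prodw f g k * (`|sumz u v k| <= h)%N%:R.
Proof.
move=> Sh.
have -> : \sum_(x in S) law x = \sum_k prodw f g k * (sumz id id k \in S)%:R.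
  rewrite (pmass_sum _ (fun x => (x \in S)%:R) (index_enum_uniq _)).
    rewrite big_mkcond /=; apply: eq_bigr => x _.
    by case: (x \in S); rewrite ?mulr1 ?mulr0.
  by move=> k; rewrite mem_index_enum.
rewrite -subr_ge0 -sumrB.
pose D (m n : nat) : R := (`|zigzag m - zigzag n| <= h)%N%:R - (nth 0 a m + nth 0 b n \in S)%:R.
have -> : \sum_k (prodw f g k * (`|sumz u v k| <= h)%N%:R - prodw f g k * (sumz id id k \in S)%:R)
   = \sum_x f x * (\sum_y g y * D (index x a) (index y b)).
  under [RHS]eq_bigr do rewrite mulr_sumr.
  rewrite pair_bigA /=; apply: eq_bigr => -[x y] _ /=.
  have [_ ma _] := fa; have [_ mb _] := gb.
  by rewrite /D /prodw /sumz /= !nth_index ?ma ?mb // mulrA mulrBr.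
have trunc (F : nat -> R) (H : nat -> R) : (forall m, (L <= m)%N -> F m = 0) ->
    \sum_(m < #|G|) F m * H m = \sum_(m < L) F m * H m.
  move=> FL; have LG' : (L <= #|G|)%N by apply: leq_trans LG; rewrite leq_addr.
  rewrite -!(big_mkord xpredT (fun m => F m * H m)) (big_cat_nat (leq0n L) LG') //=.
  rewrite -[RHS]addr0; congr (_ + _); rewrite big_nat big1 // => m /andP[Lm _].
  by rewrite FL ?mul0r.
have E (h' : G -> R) s (H : nat -> R) : ranking h' s -> (forall m, (L <= m)%N -> ranked h' s m = 0) ->
    \sum_x h' x * H (index x s) = \sum_(m < L) ranked h' s m * H m.
  move=> hs hL; rewrite (sum_ranked hs 0) -(trunc _ _ hL); apply: eq_bigr => m _.
  have [us _ _] := hs; by rewrite index_uniq ?(ranking_size hs).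
rewrite (E _ _ (fun m => \sum_y g y * D m (index y b)) fa fL).
under eq_bigr do rewrite (E _ _ _ gb gL) mulr_sumr.
under eq_bigr do under eq_bigr do rewrite mulrA.
apply: abel2_ge0.
- exact: ranked_ge0 fa f0.
- exact: ranked_leS fa f0.
- exact: ranked_ge0 gb g0.
- exact: ranked_leS gb g0.
move=> i j iL jL; rewrite /D.
under eq_bigr do rewrite sumrB.
rewrite sumrB subr_ge0.
have natr_sum2 (B : nat -> nat -> bool) :
    (\sum_(m < i) \sum_(n < j) B m n)%N%:R = \sum_(m < i) \sum_(n < j) (B m n)%:R :> R.
  by rewrite natr_sum; apply: eq_bigr => m _; rewrite natr_sum.
have := rectangle_le Sh iL jL; rewrite -(ler_nat R) natrD /far.
rewrite (natr_sum2 (fun m n => nth 0 a m + nth 0 b n \in S)).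
rewrite (natr_sum2 (fun m n => (h < `|zigzag m - zigzag n|)%N)) /= -lerBrDr.
move=> /le_trans; apply; rewrite lerBlDr -big_split /=.
under [leRHS]eq_bigr do rewrite -big_split /=.
rewrite (_ : \sum_(m < i) _ = \sum_(m < i) \sum_(n < j) 1).
  under eq_bigr do rewrite sumr_const card_ord.
  by rewrite sumr_const card_ord -mulrnA mulnC.
apply: eq_bigr => m _; apply: eq_bigr => n _.
by rewrite -natrD leqNgt; case: (_ < _)%N.
Qed.

(* Majorization holds only for prefixes of odd length.  Giving the larger mass of
   each block {2h-1, 2h} of the sorted law to both h and -h makes up for this, at
   the price of a reference weight of total mass 1 + max law. *)
Lemma rearrangement d : (forall x, law x <= d) ->
  sent f g u v - 2 * d <= sent f g id id.
Proof.
move=> ld.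
have law0 x : 0 <= law x by apply: pmass_ge0; exact: prodw_ge0.
have [c lc] := ranking_exists law.
pose Z := ranked law c; pose N := #|G|; pose w := prodw f g; pose z := sumz u v.
have Z0 m : 0 <= Z m by apply: ranked_ge0.
have Zle m n : (m <= n)%N -> Z n <= Z m by apply: ranked_le.
have ZN m : (N <= m)%N -> Z m = 0 by apply: ranked_default.
have w0 k : 0 <= w k by apply: prodw_ge0.
have [_ fs] := pf; have [_ gs] := pg.
have ws : \sum_k w k = 1 by rewrite mass_prodw fs gs mulr1.
have lawE (H : G -> R) : \sum_x law x * H x = \sum_k w k * H (sumz id id k).
  rewrite [RHS](pmass_sum _ H (index_enum_uniq _)) // => k; exact: mem_index_enum.
have laws : \sum_x law x = 1.
  by have := lawE (fun=> 1); rewrite -!mulr_suml !mulr1 ws.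
have big0 (H : nat -> R) n : (N <= n)%N -> (forall m, (N <= m)%N -> H m = 0) ->
   \sum_(m < n) H m = \sum_(m < N) H m.
  move=> Nn HN; rewrite -!(big_mkord xpredT H) (big_cat_nat (leq0n N) Nn) //=.
  rewrite -[RHS]addr0; congr (_ + _); rewrite big_nat big1 // => m /andP[? _].
  by rewrite HN.
have ZsN : \sum_(m < N) Z m = 1.
  rewrite -laws; have := sum_ranked lc 0 (fun=> 1).
  by rewrite -!mulr_suml !mulr1.
have Zs n : (N <= n)%N -> \sum_(m < n) Z m = 1 by move=> Nn; rewrite big0.
have Zs_le n : \sum_(m < n) Z m <= 1.
  by rewrite -(Zs (n + N)%N) ?leq_addl // big_split_ord /= lerDl sumr_ge0.
have dom h : \sum_(m < h.*2.+1) Z m <= \sum_k w k * (`|z k| <= h)%N%:R.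
  have [uc _ _] := lc; have sc := ranking_size lc.
  have [hN|Nh] := leqP h.*2.+1 N.
    pose S : {set G} := [set x in take h.*2.+1 c].
    have cS : #|S| = h.*2.+1 by rewrite card_prefix // sc.
    have -> : \sum_(m < h.*2.+1) Z m = \sum_(x in S) law x.
      rewrite (eq_bigl (mem (take h.*2.+1 c))); last by move=> x; rewrite inE.
      rewrite -(big_uniq _ (take_uniq _ uc)) (big_take_nth (0 : G)) ?sc //.
      apply: eq_bigr => m _; rewrite /Z /ranked (nth_map 0) // sc.
      exact: leq_trans hN.
    by apply: top_mass_le; rewrite cS.
  have cT : (#|[set: G]| <= h.*2.+1)%N by rewrite cardsT ltnW.
  apply: le_trans (top_mass_le cT).
  have -> : \sum_(x in [set: G]) law x = 1 by rewrite -laws; apply: eq_bigl => x; rewrite inE.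
  exact: Zs_le.
have umax (h' : G -> R) s x : ranking h' s -> (`|rankz s x| <= N)%N.
  move=> hs; rewrite absz_zigzag.
  have : (index x s < N)%N by have [_ ms _] := hs; rewrite /N -(ranking_size hs) index_mem ms.
  rewrite uphalf_half; lia.
have zmax k : (`|z k| <= N.*2)%N.
  have := umax _ _ k.1 fa; have := umax _ _ k.2 gb; rewrite /z /sumz.
  move: (rankz a _) (rankz b _) => x y; lia.
pose r (x : int) := Z (`|x|.*2.-1).
pose s : seq int := [seq zigzag m | m <- iota 0 N.*2.*2.+1].
have us : uniq s by rewrite map_inj_uniq ?iota_uniq //; exact: zigzag_inj.
have zs k : z k \in s.
  have [m ml mE] := zigzag_surj (z k); rewrite -mE map_f // mem_iota add0n ltnS.
  by rewrite (leq_trans ml) // leq_double.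
have r0 x : 0 <= r x by exact: Z0.
(* If [r] vanished at [z k] with h = |z k| > 0, the first 2h - 1 entries of [Z] would have mass 1,
   and [dom] at h - 1 would leave no mass of [w] at distance h from 0. *)
have rpos k : 0 < w k -> 0 < r (z k).
  move=> wk; rewrite lt_def r0 andbT; apply/negP => /eqP rz.
  pose h := `|z k|%N.
  have Zz m : (h.*2.-1 <= m)%N -> Z m = 0.
    by move=> hm; apply/eqP; rewrite eq_le Z0 andbT -rz; exact: Zle.
  have Zsum n : (h.*2.-1 <= n)%N -> \sum_(m < n) Z m = 1.
    move=> hn; rewrite -(Zs (n + N)%N) ?leq_addl // big_split_ord /= [X in _ + X]big1 ?addr0 // => i _.
    by apply: Zz; rewrite /= (leq_trans hn) // leq_addr.
  case: (posnP h) => [h0|h0].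
    by have := Zsum 0%N; rewrite h0 big_ord0 => /(_ isT)/eqP; rewrite eq_sym oner_eq0.
  have := dom h.-1; rewrite Zsum; last by lia.
  apply/negP; rewrite -ltNge -[ltRHS]ws -subr_gt0 -sumrB (bigD1 k) //=.
  have -> : (`|z k| <= h.-1)%N = false by rewrite -/h; lia.
  rewrite mulr0 subr0 ltr_pwDl // sumr_ge0 // => l _.
  by case: (_ <= _)%N; rewrite ?mulr1 ?mulr0 ?subrr ?subr0.
(* At 0 the predecessor truncates and [r] is [Z 0 <= d]. At [zigzag m.+1] the index of [Z] is at
   least m, so the other values add up to at most 1. *)
have rs : \sum_(x <- s) r x <= 1 + d.
  rewrite big_map -[X in iota 0 X]subn0 -/(index_iota 0 _) big_mkord big_ord_recl.
  rewrite addrC; apply: lerD.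
    apply: le_trans (Zs_le (N.*2.*2)); apply: ler_sum => m _.
    apply: Zle; rewrite absz_zigzag /=. lia.
  rewrite /r absz_zigzag /= /Z /ranked.
  have : (0 < size c)%N by rewrite (ranking_size lc); apply/card_gt0P; exists 0.
  by move=> c0; rewrite (nth_map 0).
have := pent_cross w0 us zs r0 rpos rs; rewrite ws -/(sent f g u v).
have -> : 1 + d - 1 = d by ring.
have d0 : 0 <= d by apply: le_trans (ld 0).
have : d / ln 2 <= 2 * d by rewrite mulrC ler_wpM2r // inv_ln2_le2.
suff : - sent f g id id <= \sum_k w k * log2 (r (z k)) by lra.
have [n0 n0P] : exists n0, forall m, (0 < Z m) = (m < n0)%N.
  have ex : exists n, Z n == 0 by exists N; rewrite ZN.
  exists (ex_minn ex); case: ex_minnP => n /eqP Zn nmin m.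
  rewrite ltnNge; case: (leqP n m) => nm /=.
    by apply/negbTE; rewrite -leNgt -Zn Zle.
  by rewrite lt_def Z0 andbT; apply/negP => /nmin; rewrite leqNgt nm.
have n0_gt0 : (0 < n0)%N.
  rewrite lt0n; apply/eqP => n00.
  have : \sum_(m < N) Z m = 0.
    rewrite big1 // => m _; apply/eqP; rewrite eq_le Z0 andbT leNgt n0P n00.
    by rewrite ltn0.
  by rewrite ZsN => /eqP; rewrite oner_eq0.
(* The smallest positive entry of [Z]. Since [log2 0 = 0], the logarithm is not monotone at 0;
   raising the entries to at least [eta] and subtracting [log2 eta] makes [F] decreasing and
   nonnegative. *)
pose eta := Z n0.-1.
have eta0 : 0 < eta by rewrite n0P prednK.
have etale m : 0 < Z m -> eta <= Z m by rewrite n0P => h; apply: Zle; lia.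
pose F h := log2 (Num.max (Z h.*2.-1) eta) - log2 eta.
have F0 h : 0 <= F h by rewrite subr_ge0 ler_log2 // le_max lexx orbT.
have Fd h : F h.+1 <= F h.
  rewrite lerB // ler_log2 ?lt_max ?eta0 ?orbT // ge_max !le_max lexx orbT andbT.
  by rewrite Zle //; lia.
pose om h := \sum_k w k * (`|z k| == h)%N%:R.
have omP H : \sum_(h < H.+1) om h = \sum_k w k * (`|z k| <= H)%N%:R.
  rewrite exchange_big /=; apply: eq_bigr => k _; rewrite -mulr_sumr; congr (_ * _).
  case: leqP => zH.
    rewrite (bigD1 (Ordinal (zH : `|z k| < H.+1)%N)) //= eqxx big1 ?addr0 // => h hz.
    case: eqP => // E; case/eqP: hz; exact/val_inj.
  by rewrite big1 // => h _; case: eqP => // E; have := ltn_ord h; lia.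
have domom H : (H <= N.*2)%N -> \sum_(m < H.*2.+1) Z m <= \sum_(h < H.+1) om h.
  by move=> _; rewrite omP; exact: dom.
have := abel_blocks F0 Fd domom.
have -> : \sum_(h < N.*2.+1) F h * om h = \sum_k w k * log2 (r (z k)) - log2 eta.
  rewrite /om; under eq_bigr do rewrite mulr_sumr.
  have -> : log2 eta = \sum_k w k * log2 eta by rewrite -mulr_suml ws mul1r.
  rewrite exchange_big -sumrB; apply: eq_bigr => k _.
  have zk : (`|z k| < N.*2.+1)%N by rewrite ltnS zmax.
  rewrite (bigD1 (Ordinal zk)) //= eqxx mulr1 big1 ?addr0; last first.
    move=> h hz; case: eqP => [E|_]; last by rewrite !mulr0.
    by case/eqP: hz; exact/val_inj.
  have := w0 k; rewrite le_eqVlt => /predU1P[<-|wk]; first by rewrite !(mul0r, mulr0) subrr.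
  rewrite -mulrBr mulrC /F /r; congr (_ * (log2 _ - _)).
  by apply/max_idPl/etale/rpos.
have -> : - sent f g id id = \sum_(m < (N.*2).*2.+1) Z m * log2 (Z m).
  rewrite (big0 (fun m => Z m * log2 (Z m))); [|by lia|by move=> m /ZN ->; rewrite mul0r].
  rewrite /sent /pent opprK -(lawE (fun x => log2 (law x))).
  rewrite (sum_ranked lc 0); apply: eq_bigr => m _; congr (_ * log2 _).
  by rewrite /Z /ranked (nth_map 0) // (ranking_size lc).
move=> H; rewrite -(@lerD2r _ (- log2 eta)); apply: le_trans H.
have {1}-> : log2 eta = \sum_(m < (N.*2).*2.+1) Z m * log2 eta.
  by rewrite -mulr_suml Zs ?mul1r //; lia.
rewrite -sumrB; apply: ler_sum => m _.
have := Z0 m; rewrite le_eqVlt => /predU1P[<-|Zm]; first by rewrite !mul0r subrr.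
rewrite -mulrBr ler_pM2l // lerD2r ler_log2 // le_max Zle // uphalf_half; lia.
Qed.

End Rearrange.

(** * Cyclic groups of prime order *)

Section Restrict.
Context {R : realType} {G : finZmodType}.
Implicit Types f g : G -> R.

Lemma law_le f g d x : prob g -> (forall i, f i <= d) -> (forall i, 0 <= f i) ->
  pmass (prodw f g) (sumz id id) x <= d.
Proof.
move=> [g0 gs] fd f0; rewrite /pmass big_mkcond /=.
rewrite -(pair_bigA _ (fun i j => if sumz id id (i, j) == x then prodw f g (i, j) else 0)) /=.
rewrite exchange_big /= -[leRHS]mul1r -gs mulr_suml; apply: ler_sum => j _.
rewrite (bigD1 (x - j)) //= big1 ?addr0; last first.
  move=> i ij; rewrite /sumz /=; case: eqP => // E; by rewrite -E addrK eqxx in ij.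
by rewrite /sumz /= subrK eqxx /prodw mulrC ler_wpM2l.
Qed.

Lemma sent_sum f g : sent f g id id = \sum_x plogp (pmass (prodw f g) (sumz id id) x).
Proof.
by rewrite /sent (pent_sum _ (index_enum_uniq _)) // => k; rewrite mem_index_enum.
Qed.

(** Write [f] as the mixture of [F] and a law [F'] with weights [a] and [1 - a]. The entropy of the
    sum is concave in [f], and [F'] gives at least the mean of the entropies. The entropy of [f]
    exceeds the mixture of entropies by the binary entropy of [a]; half of it is the loss. *)
Lemma sent_split f g (P : pred G) c : prob f -> prob g ->
  let a := \sum_(x | P x) f x in
  let F x := if P x then f x / a else 0 in
  0 < a -> (ent F + ent g) / 2 + c <= sent F g id id ->
  (ent f + ent g) / 2 + (a * c - (plogp a + plogp (1 - a)) / 2) <= sent f g id id.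
Proof.
move=> pf pg a F a0 H; have [f0 fs] := pf; have [g0 gs] := pg.
(* For [t = 0] the function [F'] is 0 and not a law, hence the facts on [F'] carry the factor
   [t]. *)
pose t := 1 - a; pose F' x := if P x then 0 else f x / t.
have tE : t = \sum_(x | ~~ P x) f x.
  by rewrite /t -fs (bigID P) /= addrAC subrr add0r.
have t0 : 0 <= t by rewrite tE sumr_ge0.
have tF' x : t * F' x = if P x then 0 else f x.
  rewrite /F'; case: ifP => Px; first by rewrite mulr0.
  have [t00|tn0] := eqVneq t 0; last by rewrite mulrC divfK.
  rewrite t00 mul0r; apply/esym/eqP; rewrite eq_le f0 andbT -t00 tE (bigD1 x) ?Px //=.
  by rewrite lerDl sumr_ge0.
have aF x : a * F x = if P x then f x else 0.
  by rewrite /F; case: ifP => _; rewrite ?mulr0 // mulrC divfK // gt_eqF.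
have fE x : f x = a * F x + t * F' x.
  by rewrite aF tF'; case: ifP => _; rewrite ?addr0 ?add0r.
have F0 x : 0 <= F x by rewrite /F; case: ifP => // _; rewrite divr_ge0 // ltW.
have F'0 x : 0 <= F' x by rewrite /F'; case: ifP => // _; rewrite divr_ge0.
have Fs : \sum_x F x = 1.
  by apply: (mulfI (lt0r_neq0 a0)); rewrite mulr_sumr mulr1 /a [RHS]big_mkcond; apply: eq_bigr => x _; exact: aF.
have entE : ent f = a * ent F + plogp a + (t * ent F' + plogp t).
  have e1 : a * ent F + plogp a = \sum_x plogp (a * F x).
    under eq_bigr do rewrite (plogpM (ltW a0) (F0 _)).
    by rewrite big_split /= -mulr_sumr -mulr_suml Fs mul1r.
  have e2 : t * ent F' + plogp t = \sum_x plogp (t * F' x).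
    under eq_bigr do rewrite (plogpM t0 (F'0 _)).
    rewrite big_split /= -mulr_sumr -mulr_suml; congr (_ + _).
    have [->|tn0] := eqVneq t 0; first by rewrite plogp0 mulr0.
    have : t * \sum_x F' x = t.
      rewrite mulr_sumr {2}tE [RHS]big_mkcond; apply: eq_bigr => x _.
      by rewrite tF'; case: (P x).
    by rewrite -{2}[t]mulr1 => /(mulfI tn0) ->; rewrite mul1r.
  rewrite e1 e2 -big_split /=; apply: eq_bigr => x _.
  by rewrite aF tF'; case: ifP => _; rewrite plogp0 ?addr0 ?add0r.
have lin : a * sent F g id id + t * sent F' g id id <= sent f g id id.
  rewrite !sent_sum !mulr_sumr -big_split /=; apply: ler_sum => x _.
  apply: le_trans (plogp_concave _ _ (ltW a0) t0 _) _.
  - by apply: pmass_ge0; exact: prodw_ge0.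
  - by apply: pmass_ge0; exact: prodw_ge0.
  - by rewrite /t addrC subrK.
  rewrite le_eqVlt; apply/orP; left; apply/eqP; congr plogp.
  rewrite /pmass !mulr_sumr -big_split /=; apply: eq_bigr => k _.
  by rewrite /prodw fE; ring.
have H' : t * ((ent F' + ent g) / 2) <= t * sent F' g id id.
  move: t0; rewrite le_eqVlt => /predU1P[<-|tpos]; first by rewrite !mul0r.
  rewrite ler_pM2l //.
  have pF' : prob F'.
    split=> //; apply: (mulfI (lt0r_neq0 tpos)); rewrite mulr_sumr mulr1 {2}tE [RHS]big_mkcond.
    by apply: eq_bigr => x _; rewrite tF'; case: (P x).
  have idi : injective (@id G) by [].
  have := ent_le_sent id pF' pg idi; have := ent_le_sent id pg pF' idi.
  by rewrite sent_swap; lra.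
have := ler_wpM2l (ltW a0) H.
move: lin H'; rewrite entE -/t.
have -> : a = 1 - t by rewrite /t; ring.
set A := sent F g _ _; set B := sent F' g _ _; set X := ent F; set Y := ent F'.
set W := ent g; lra.
Qed.

End Restrict.

Section Tail.
Context {R : realType} {G : finZmodType}.
Variables (f g : G -> R) (a : seq G).
Hypotheses (pf : prob f) (pg : prob g) (fa : ranking f a) (N2 : (2 <= #|G|)%N).
Local Notation N := #|G|.
Local Notation L := (#|G|./2).

(** With [t] the mass outside the [L] largest values, each of these values is at least [t / N]. So
    [f] dominates a flat weight on [L] points, of total at least [t / 4] because N <= 4L, and of
    normalized entropy log L >= log N - 2. This weight goes into [sent_ge_part]. *)
Lemma tail_gain : ent g <= log2 (N%:R) - 2 ->
  (1 - \sum_(x | (index x a < L)%N) f x) / 4 * (log2 N%:R - 2 - ent g) + ent g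
    <= sent f g id id.
Proof.
move=> gN; have [f0 fs] := pf; have [ua ma _] := fa.
set P := fun x => (index x a < L)%N.
set t := 1 - _.
have tE : t = \sum_(x | ~~ P x) f x.
  by rewrite /t -fs (bigID P) /= addrAC subrr add0r.
have t0 : 0 <= t by rewrite tE sumr_ge0.
have L0 : (0 < L)%N by rewrite half_gt0.
have LN : (L < N)%N by lia.
have N4 : N%:R <= 4 * L%:R :> R by rewrite -natrM ler_nat; lia.
have NR0 : 0 < N%:R :> R by rewrite ltr0n; lia.
have LR0 : 0 < L%:R :> R by rewrite ltr0n.
have cP : #|[pred x | P x]| = L.
  have <- : #|[set x in take L a]| = L by apply: card_prefix => //; rewrite (ranking_size fa) ltnW.
  apply: eq_card => x; rewrite !inE /P.
  by rewrite in_take ?ma.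
pose k := t / N%:R.
have k0 : 0 <= k by rewrite divr_ge0 // ltW.
have kf x : P x -> k <= f x.
  move=> Px; rewrite /k ler_pdivrMr // tE.
  apply: (@le_trans _ _ (\sum_(y | ~~ P y) f x)).
    apply: ler_sum => y; rewrite -leqNgt => Py.
    rewrite -(ranked_index fa y) -(ranked_index fa x); apply: ranked_le => //.
    exact: leq_trans (ltnW Px) Py.
  rewrite sumr_const -[f x *+ _]mulr_natr ler_wpM2l // ler_nat; exact: max_card.
pose f' x := if P x then k else 0.
have f'f x : 0 <= f' x <= f x.
  by rewrite /f'; case: ifP => Px; rewrite ?k0 ?kf ?lexx ?f0.
have idi : injective (@id G) by [].
have := sent_ge_part pf pg idi idi f'f.
have -> : \sum_x f' x = k * L%:R.
  by rewrite -big_mkcond /= sumr_const cP mulr_natr.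
have -> : ent f' = plogp k * L%:R.
  rewrite /ent (eq_bigr (fun x => if P x then plogp k else 0)); last first.
    by move=> x _; rewrite /f'; case: ifP; rewrite ?plogp0.
  by rewrite -big_mkcond /= sumr_const cP mulr_natr.
rewrite (plogpM k0 (ltW LR0)) {2}/plogp.
have lL : log2 N%:R - 2 <= log2 L%:R :> R.
  rewrite lerBlDr -(log2_pow2 2) -log2M ?exprn_gt0 // ler_log2 //.
  by rewrite mulrC -natrX.
have w4 : t / 4 <= k * L%:R.
  rewrite /k mulrAC ler_pdivlMr // mulrAC -mulrA.
  by apply: ler_wpM2l => //; rewrite ler_pdivrMr // mulrC.
move=> H; apply: le_trans H.
have h1 : t / 4 * (log2 N%:R - 2 - ent g) <= k * L%:R * (log2 N%:R - 2 - ent g).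
  by rewrite ler_wpM2r // subr_ge0.
have h2 : k * L%:R * (log2 N%:R - 2) <= k * L%:R * log2 L%:R.
  by rewrite ler_wpM2l // mulr_ge0 // ltW.
set l := log2 L%:R; rewrite -/l in h2; lra.
Qed.

End Tail.

Lemma ranking_head {R : realType} {T : finType} (f : T -> R) (s : seq T) L c :
  ranking f s -> (forall x, 0 <= f x) -> 0 <= c ->
  ranking (fun x => if (index x s < L)%N then f x / c else 0) s.
Proof.
move=> fs f0 c0; have [us ms ss] := fs; split => //.
case: s us ms ss {fs} => [//|x0 s] us ms ss.
apply/(sortedP x0) => i si; rewrite !index_uniq ?(ltnW si) //.
have := ss => /(sortedP x0)/(_ i si) h.
case: (ltnP i.+1 L) => iL; first by rewrite (ltnW iL) ler_wpM2r // invr_ge0.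
by case: ifP => // _; rewrite divr_ge0.
Qed.

Lemma ranked_head {R : realType} {T : finType} (f : T -> R) (s : seq T) L c m :
  ranking f s -> (L <= m)%N ->
  ranked (fun x => if (index x s < L)%N then f x / c else 0) s m = 0.
Proof.
move=> [us ms _] Lm; rewrite /ranked.
case: (ltnP m (size s)) => ms'; last by rewrite nth_default // size_map.
case: s us ms ms' => [//|x0 s] us ms ms'.
by rewrite (nth_map x0) // index_uniq // ltnNge Lm.
Qed.

(** The tail gains at least 1800 / 4096 > 1/4 over [e2], which is within 1/8 of the mean. The gap
    1900 in place of 2000 lets either law play [e1]. *)
Lemma tail_gain_le {R : realType} (t l e1 e2 s : R) :
  1 / 1024 < t -> e1 <= l - 19 * 100 -> e2 <= e1 + 1 / 4 -> e1 <= e2 + 1 / 4 ->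
  (e2 <= l - 2 -> t / 4 * (l - 2 - e2) + e2 <= s) -> (e1 + e2) / 2 + 1 / 8 <= s.
Proof.
move=> t0 h1 h2 h3 /(_ ltac:(lra)).
have : 1 / 1024 * (18 * 100) <= t * (l - 2 - e2) by apply: ler_pM; lra.
by set X := t * (l - 2 - e2); rewrite [t / 4 * _]mulrAC -/X; lra.
Qed.

(** [plogp_le_compl] gives 2/1024 and [plogp_le_pow2] with n = 10 gives 12/1024; half of the sum is
    7/1024. *)
Lemma plogp_loss {R : realType} (x : R) : x <= 1 -> 1 - x <= 1 / 1024 ->
  (plogp x + plogp (1 - x)) / 2 <= 7 / 1024.
Proof.
move=> x1 tx; have x0 : 0 <= x by lra.
have := plogp_le_compl x0 x1.
have e10 : (2 : R) ^- 10 = 1 / 1024 by rewrite -natrX mul1r; congr (_ ^-1).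
have := @plogp_le_pow2 R 10 (1 - x); rewrite e10 subr_ge0 => /(_ x1 tx); lra.
Qed.

(** The gain 1/8 + 1/32 of the restricted laws survives two uses of [sent_split]; after the first
    one it is still above 1/7. *)
Lemma restrict_arith {R : realType} (a b p q : R) :
  p / 2 <= 7 / 1024 -> q / 2 <= 7 / 1024 -> 1023 / 1024 <= a -> 1023 / 1024 <= b ->
  1 / 8 <= a * (b * (1 / 8 + 1 / 32) - q / 2) - p / 2.
Proof.
move=> hp hq ha hb.
have b1 : 1023 / 1024 * (1 / 8 + 1 / 32) <= b * (1 / 8 + 1 / 32) by apply: ler_pM; lra.
have b2 : 1023 / 1024 * (1 / 7) <= a * (b * (1 / 8 + 1 / 32) - q / 2) by apply: ler_pM; lra.
by move: b2; set X := a * _; lra.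
Qed.

Lemma finite_cyclic_gain {R : realType} {G : finZmodType} (f g : G -> R) :
  @no_period G -> (2 <= #|G|)%N -> prob f -> prob g -> 110 * 100 <= ent f ->
  ent f <= log2 #|G|%:R - 20 * 100 ->
  (ent f + ent g) / 2 + 1 / 8 <= sent f g id id.
Proof.
move=> np N2 pf pg hf fN; have idi : injective (@id G) by [].
apply: gain_reduce => // fg gf fd gd.
have [a fa] := ranking_exists f; have [b gb] := ranking_exists g.
have [f0 fs] := pf; have [g0 gs] := pg.
set L := #|G|./2.
set al := \sum_(x | (index x a < L)%N) f x.
set be := \sum_(x | (index x b < L)%N) g x.
have e11 : (2 : R) ^- 11 = 1 / 2048 by rewrite -natrX mul1r; congr (_ ^-1).
have e10 : (2 : R) ^- 10 = 1 / 1024 by rewrite -natrX mul1r; congr (_ ^-1).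
have al1 : al <= 1 by rewrite -fs /al [leLHS]big_mkcond; apply: ler_sum => x _; case: ifP.
have be1 : be <= 1 by rewrite -gs /be [leLHS]big_mkcond; apply: ler_sum => x _; case: ifP.
have [tf|tf] := ltP (1 / 1024) (1 - al).
  by apply: tail_gain_le tf _ gf fg (tail_gain pf pg fa N2); lra.
have [tg|tg] := ltP (1 / 1024) (1 - be).
  have := tail_gain_le tg _ fg gf (tail_gain pg pf gb N2).
  by rewrite sent_swap [ent g + _]addrC; apply; lra.
clear fN hf fg gf.
pose F x := if (index x a < L)%N then f x / al else 0.
pose H x := if (index x b < L)%N then g x / be else 0.
have al0 : 0 < al by lra.
have be0 : 0 < be by lra.
have normal (h : G -> R) s c : (forall x, 0 <= h x) -> 0 < c ->
    c = \sum_(x | (index x s < L)%N) h x -> prob (fun x => if (index x s < L)%N then h x / c else 0).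
  move=> h0 c0 cE; split=> [x|]; first by case: ifP => // _; rewrite divr_ge0 // ltW.
  by rewrite -big_mkcond /= -mulr_suml -cE divff // gt_eqF.
have pF : prob F by apply: normal.
have pH : prob H by apply: normal.
(* Normalizing by at least 1/2 at most doubles an atom. *)
have atoms (h : G -> R) s c : (forall x, h x <= 2 ^- 11) -> 1 / 2 <= c -> forall x,
   (if (index x s < L)%N then h x / c else 0) <= 2 ^- 10.
  move=> hd c2 x; case: ifP => _; last by rewrite e10; lra.
  have := hd x; rewrite e10 e11 ler_pdivrMr; last by lra.
  move=> ?; lra.
have Fd x : F x <= 2 ^- 10 by apply: atoms => //; lra.
have Hd x : H x <= 2 ^- 10 by apply: atoms => //; lra.
have rF : ranking F a by apply: ranking_head => //; exact: ltW.
have rH : ranking H b by apply: ranking_head => //; exact: ltW.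
have LG : (L + L <= #|G|)%N by rewrite addnn -[leqRHS]odd_double_half leq_addl.
have law1 x : pmass (prodw F H) (sumz id id) x <= 2 ^- 10.
  by apply: law_le => //; case: pF.
have R1 := rearrangement np pF pH rF rH LG (fun m => ranked_head al fa) (fun m => ranked_head be gb) law1.
have vinj : injective (fun y => - rankz b y) by move=> x y /oppr_inj /(rankz_inj rH).
have R2 := ordered_gain pF pH (rankz_inj rF) vinj Fd Hd.
(* Below 5/28 minus the cost 2 / 1024 of the rearrangement and the tiny cost of the atom at the
   medians. *)
pose c0 : R := 1 / 8 + 1 / 32.
have S0 : (ent H + ent F) / 2 + c0 <= sent H F id id.
  rewrite sent_swap; move: R1 R2; rewrite e10 /c0.
  have := @log2_3_ge R; have := @log2_3_le2 R.
  set l := log2 3; set A := sent F H _ _; set B := sent F H _ _; lra.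
have S1 := sent_split pg pF be0 S0.
rewrite -/be sent_swap in S1.
have S2 := sent_split (c := be * c0 - (plogp be + plogp (1 - be)) / 2) pf pg al0.
have := plogp_loss al1 tf; have := plogp_loss be1 tg.
have {}S2 := S2 ltac:(rewrite -/F; move: S1; lra).
move: S2; rewrite -/al -/c0 => S2 q2 q1; apply: le_trans S2; rewrite lerD2l.
apply: (restrict_arith q1 q2); lra.
Qed.

Local Open Scope classical_set_scope.

(** * Random variables *)

(** Compare with the reference weight [q]: since [- log2 (q t)] is nonnegative, replacing [c] times
    the law by the larger [q] only increases the cross entropy. *)
Lemma pent_le_cross {R : realType} (K : finType) (T0 : eqType) (w : K -> R)
    (z : K -> T0) (s : seq T0) (q : T0 -> R) c :
  prob w -> uniq s -> (forall k, z k \in s) -> 0 <= c ->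
  (forall t, c * pmass w z t <= q t <= 1) -> \sum_(t <- s) q t <= 1 ->
  c * pent w z <= \sum_(t <- s) plogp (q t).
Proof.
move=> [w0 ws] us zs; rewrite le_eqVlt => /predU1P[<-|c0] Hq qs.
  rewrite mul0r sumr_ge0 // => t _; have /andP[] := Hq t; rewrite mul0r; exact: plogp_ge0.
have q0 t : 0 <= q t.
  by case/andP: (Hq t) => + _; apply: le_trans; rewrite mulr_ge0 ?(ltW c0) // pmass_ge0.
have qpos k : 0 < w k -> 0 < q (z k).
  move=> wk; case/andP: (Hq (z k)) => + _; apply: lt_le_trans; rewrite mulr_gt0 //.
  exact: lt_le_trans wk (pmass_ge _ w0 k).
have := pent_cross w0 us zs q0 qpos qs; rewrite ws subrr mul0r addr0.
rewrite (pmass_sum _ (fun t => log2 (q t)) us zs) => /(ler_wpM2l (ltW c0)) /le_trans; apply.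
rewrite mulrN mulr_sumr -sumrN; apply: ler_sum => t _; rewrite /plogp lerN2 [leRHS]mulrA.
have /andP[h1 h2] := Hq t. apply: ler_wnM2r => //.
by rewrite /log2 mulr_le0_ge0 ?ln_le0 // invr_ge0 ltW // ln2_gt0.
Qed.

Lemma ler_sum_uniq {R : realType} (K : eqType) (s1 s2 : seq K) (F : K -> R) :
  uniq s1 -> uniq s2 -> {subset s1 <= s2} -> (forall x, 0 <= F x) ->
  \sum_(x <- s1) F x <= \sum_(x <- s2) F x.
Proof.
move=> u1 u2 s12 F0; rewrite [leRHS](bigID (fun x => x \in s1)) /=.
have -> : \sum_(x <- s2 | x \in s1) F x = \sum_(x <- s1) F x.
  rewrite -big_filter; apply: perm_big; apply: uniq_perm; rewrite ?filter_uniq // => x.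
  by rewrite mem_filter; case: (boolP (x \in s1)) => //= /s12 ->.
by rewrite lerDl sumr_ge0.
Qed.

Section Glue.
Context {d : measure_display} {T : measurableType d} {R : realType}.
Variable P : probability T R.

Definition mass {G : Type} (X : T -> G) (x : G) : R := fine (P (X @^-1` [set x])).

Lemma mass_ge0 {G : Type} (X : T -> G) x : 0 <= mass X x.
Proof. by rewrite fine_ge0. Qed.

Lemma fine_sum_le (K : choiceType) (s : seq K) (A : K -> set T) (B : set T) :
  uniq s -> (forall k, measurable (A k)) -> measurable B ->
  trivIset setT A -> (forall k, k \in s -> A k `<=` B) ->
  \sum_(k <- s) fine (P (A k)) <= fine (P B).
Proof.
move=> us mA mB tA AB.
rewrite -lee_fin fineK ?fin_num_measure // -sumEFin.
under eq_bigr do rewrite fineK ?fin_num_measure //.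
rewrite fsbig_seq // -measure_fin_bigcup //.
- apply: le_measure; rewrite ?inE //; first exact: fin_bigcup_measurable.
  by apply: bigcup_sub => k /=; exact: AB.
- by move=> i j _ _; exact: tA.
Qed.

Lemma trivIset_preimage {G : Type} (X : T -> G) :
  trivIset setT (fun x : G => X @^-1` [set x]).
Proof. by move=> x y _ _ [t [/= <- <-]]. Qed.

Lemma mass_le1 {G : Type} (X : T -> G) x : measurable (X @^-1` [set x]) -> mass X x <= 1.
Proof.
move=> mX; rewrite /mass -lee_fin fineK ?fin_num_measure //.
exact: probability_le1.
Qed.

Lemma sum_mass_le1 {G : choiceType} (X : T -> G) (s : seq G) :
  (forall x, measurable (X @^-1` [set x])) -> uniq s -> \sum_(x <- s) mass X x <= 1.
Proof.
move=> mX us.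
have -> : 1 = fine (P setT) by rewrite probability_setT.
by apply: fine_sum_le => //; exact: trivIset_preimage.
Qed.

Lemma entropy_ge (G : choiceType) (X : T -> G) (s : seq G) :
  (forall x, measurable (X @^-1` [set x])) -> uniq s ->
  ((\sum_(x <- s) plogp (mass X x))%:E <= entropy P X)%E.
Proof.
move=> mX us; apply: esum_ge; exists [set` s].
  by split; [exact: finite_seq | move=> ?].
by rewrite -sumEFin fsbig_seq.
Qed.

Lemma entropy_ge0 (G : choiceType) (X : T -> G) :
  (forall x, measurable (X @^-1` [set x])) -> (0 <= entropy P X)%E.
Proof. by move=> mX; have := entropy_ge mX (isT : uniq [::]); rewrite big_nil. Qed.

Section Sum.
Context {G : zmodType} {I J : finType}.
Variables (X Y : T -> G) (u : I -> G) (v : J -> G).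
Hypotheses (mX : forall x, measurable (X @^-1` [set x])).
Hypotheses (mY : forall x, measurable (Y @^-1` [set x])).
Hypotheses (mZ : forall x, measurable ((fun t => X t + Y t) @^-1` [set x])).
Hypothesis indep : forall x y, P (X @^-1` [set x] `&` Y @^-1` [set y]) =
  (P (X @^-1` [set x]) * P (Y @^-1` [set y]))%E.
Hypotheses (uinj : injective u) (vinj : injective v).

(** The law of X + Y dominates [a * b] times the law of the sum of the two normalized truncations,
    so [pent_le_cross] applies with [c = a * b]. *)
Lemma entropy_sum_ge (a b : R) :
  a = \sum_i mass X (u i) -> b = \sum_j mass Y (v j) -> 0 < a -> 0 < b ->
  ((a * b * sent (fun i => mass X (u i) / a) (fun j => mass Y (v j) / b) u v)%:E
    <= entropy P (fun t => X t + Y t)%R)%E.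
Proof.
move=> aE bE a0 b0; set f := fun i => _; set g := fun j => _.
have pw : prob (prodw f g).
  split; first by move=> k; rewrite mulr_ge0 // divr_ge0 ?mass_ge0 // ltW.
  by rewrite mass_prodw -!mulr_suml -aE -bE !divff ?gt_eqF // mulr1.
pose s := undup [seq sumz u v k | k : I * J].
have us : uniq s by rewrite undup_uniq.
have zs k : sumz u v k \in s by rewrite mem_undup map_f // mem_enum.
apply: le_trans (entropy_ge mZ us); rewrite lee_fin.
apply: pent_le_cross => //; first by rewrite mulr_ge0 // ltW.
- move=> t; rewrite mass_le1 // andbT.
  have -> : a * b * pmass (prodw f g) (sumz u v) t =
      \sum_(k <- [seq k <- enum {: I * J} | sumz u v k == t])
         fine (P (X @^-1` [set u k.1] `&` Y @^-1` [set v k.2])).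
    rewrite big_filter big_enum_cond /= /pmass mulr_sumr; apply: eq_bigr => k _.
    rewrite indep fineM ?fin_num_measure // /prodw /f /g /mass.
    by field; rewrite !gt_eqF.
  apply: fine_sum_le => //.
  + by rewrite filter_uniq // enum_uniq.
  + by move=> k; exact: measurableI.
  + by move=> [i j] [i' j'] _ _ [w [[/= -> ->] [/= /uinj -> /vinj ->]]].
  + by move=> k; rewrite mem_filter => /andP[/eqP <- _] w [/= -> ->].
- exact: sum_mass_le1.
Qed.

End Sum.

End Glue.

Lemma entropy_finType {d : measure_display} {T : measurableType d} {R : realType}
    (P : probability T R) (G : finType) (X : T -> G) :
  (forall x, measurable (X @^-1` [set x])) ->
  entropy P X = (ent (mass P X))%:E.
Proof.
move=> mX; rewrite /entropy; have -> : [set: G] = [set` index_enum G].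
  by apply/seteqP; split => // x _; rewrite /= mem_index_enum.
rewrite esum_fset.
- by rewrite -sumEFin -fsbig_seq ?index_enum_uniq.
- exact: finite_seq.
- by move=> x _; rewrite lee_fin; apply: plogp_ge0; rewrite ?fine_ge0 // mass_le1.
Qed.

Lemma sum_mass_finType {d : measure_display} {T : measurableType d} {R : realType}
    (P : probability T R) (G : finType) (X : T -> G) :
  (forall x, measurable (X @^-1` [set x])) -> \sum_x mass P X x = 1.
Proof.
move=> mX; apply/EFin_inj; rewrite -sumEFin -(probability_setT P).
under eq_bigr do rewrite /mass fineK ?fin_num_measure //.
rewrite (_ : setT = \bigcup_(x in [set` index_enum G]) X @^-1` [set x]).
  rewrite measure_fin_bigcup -?fsbig_seq ?index_enum_uniq //.
  by move=> i j _ _; exact: trivIset_preimage.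
by apply/seteqP; split => // t _; exists (X t); rewrite //= mem_index_enum.
Qed.

Lemma cyclic_gain {d : measure_display} {T : measurableType d} {R : realType}
    (P : probability T R) (p : nat) (X Y : {dRV P >-> 'F_p}) :
  prime p -> independent_RV P X Y ->
  ((110 * 100)%:E <= entropy P X)%E ->
  (entropy P X < (log2 p%:R - 20 * 100)%:E)%E ->
  ((1 / 2)%:E * entropy P X + (1 / 2)%:E * entropy P Y + (1 / 8)%:E
    <= entropy P (X \+ Y)%R)%E.
Proof.
move=> pp indep.
have mall (A : set 'F_p) : measurable A by [].
have mX x : measurable (X @^-1` [set x]).
  by rewrite -[X in measurable X]setTI; exact: measurable_funP.
have mY x : measurable (Y @^-1` [set x]).
  by rewrite -[X in measurable X]setTI; exact: measurable_funP.
have mZ z : measurable ((fun t => X t + Y t) @^-1` [set z]).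
  have -> : (fun t => X t + Y t) @^-1` [set z] =
      \bigcup_(x in [set` index_enum 'F_p]) (X @^-1` [set x] `&` Y @^-1` [set z - x]).
    apply/seteqP; split => [t /= <-|t [x _ [/= -> ->]]]; last by rewrite addrC subrK.
    by exists (X t); rewrite /= ?mem_index_enum // addrC addKr.
  by apply: fin_bigcup_measurable => // x _; exact: measurableI.
have indep' x y : P (X @^-1` [set x] `&` Y @^-1` [set y]) =
  (P (X @^-1` [set x]) * P (Y @^-1` [set y]))%E by exact: indep.
have sX := sum_mass_finType P mX; have sY := sum_mass_finType P mY.
have pX : prob (mass P X) by split=> // x; exact: mass_ge0.
have pY : prob (mass P Y) by split=> // x; exact: mass_ge0.
rewrite (entropy_finType P mX) (entropy_finType P mY) lee_fin lte_fin => h1 h2.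
have idi : injective (@id 'F_p) by [].
have cp : #|'F_p| = p by rewrite card_Fp.
have := entropy_sum_ge mX mY mZ indep' idi idi (esym sX) (esym sY) ltr01 ltr01.
apply: le_trans; rewrite -!EFinM -!EFinD lee_fin !mul1r.
have := @finite_cyclic_gain R 'F_p (mass P X) (mass P Y) (no_period_Fp pp).
rewrite cp prime_gt1 // => /(_ isT pX pY h1 (ltW h2)).
have -> : sent (fun i => mass P X (id i) / 1) (fun j => mass P Y (id j) / 1) id id
    = sent (mass P X) (mass P Y) id id.
  by congr sent; apply/funext => i; rewrite divr1.
set s := sent _ _ _ _; lra.
Qed.

(** * Discrete real variables by truncation *)

Section Real.
Context {d : measure_display} {T : measurableType d} {R : realType}.
Variable P : probability T R.

Lemma esum_approx (K : choiceType) (F : K -> R) (x y : R) :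
  x < y -> (y%:E <= \esum_(k in [set: K]) (F k)%:E)%E ->
  exists2 s : seq K, uniq s & x <= \sum_(k <- s) F k.
Proof.
move=> xy yS.
have : (x%:E < \esum_(k in [set: K]) (F k)%:E)%E by apply: lt_le_trans yS; rewrite lte_fin.
move=> /ereal_sup_gt [_ [S [fS _] <-]].
rewrite fsbig_finite // sumEFin lte_fin => /ltW h.
by exists (finmap.enum_fset (fset_set S)) => //; exact: finmap.fset_uniq.
Qed.

Lemma esum_mass (X : {dRV P >-> R}) :
  (1 <= \esum_(x in [set: R]) (mass P X x)%:E)%E.
Proof.
have mX x : measurable (X @^-1` [set x]).
  by rewrite -[Y in measurable Y]setTI; exact: measurable_funP.
have m0 x : (0 <= (mass P X x)%:E)%E by rewrite lee_fin mass_ge0.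
have E : (\sum_(n <oo) enum_prob X n = \esum_(n in dRV_dom X) (mass P X (dRV_enum X n))%:E)%E.
  rewrite nneseries_esumT; last first.
    by move=> n; rewrite /enum_prob patchE; case: ifP.
  rewrite [RHS]esum_mkcond; apply: eq_esum => n _; rewrite /enum_prob patchE.
  by case: ifP => // _; rewrite /mass fineK // fin_num_measure.
rewrite -(@sum_enum_prob _ _ _ _ _ P X) // E.
rewrite -(esum_image (dRV_dom X) (dRV_enum X) (fun x => (mass P X x)%:E)); last first.
  by move=> m n; exact: inj.
rewrite esum_mkcond; apply: le_esum => x _; case: ifP => // _.
Qed.

Lemma entropy_approx (X : {dRV P >-> R}) (A e : R) : 0 < e ->
  (A%:E <= entropy P X)%E ->
  exists2 s : seq R, uniq s & A - e <= \sum_(x <- s) plogp (mass P X x)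
    /\ 1 - e <= \sum_(x <- s) mass P X x.
Proof.
move=> e0 AX.
have mX x : measurable (X @^-1` [set x]).
  by rewrite -[Y in measurable Y]setTI; exact: measurable_funP.
have Ae : A - e < A by lra.
have e1 : 1 - e < 1 by lra.
have [s1 u1 h1] := esum_approx Ae AX.
have [s2 u2 h2] := esum_approx e1 (esum_mass X).
exists (undup (s1 ++ s2)); rewrite ?undup_uniq //; split.
  apply: le_trans h1 _; apply: ler_sum_uniq; rewrite ?undup_uniq //.
    by move=> x; rewrite mem_undup mem_cat => ->.
  by move=> x; apply: plogp_ge0; rewrite ?mass_ge0 ?mass_le1.
apply: le_trans h2 _; apply: ler_sum_uniq; rewrite ?undup_uniq //.
  by move=> x; rewrite mem_undup mem_cat orbC => ->.
by move=> x; exact: mass_ge0.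
Qed.

Lemma ent_normalize (I : finType) (f : I -> R) (a : R) :
  (forall i, 0 <= f i) -> a = \sum_i f i -> 0 < a ->
  a * ent (fun i => f i / a) = ent f - plogp a.
Proof.
move=> f0 aE a0.
have E i : plogp (f i) = a * plogp (f i / a) + f i / a * plogp a.
  rewrite -plogpM ?divr_ge0 ?(ltW a0) //; congr plogp.
  by rewrite mulrC divfK // gt_eqF.
rewrite /ent (eq_bigr _ (fun i _ => E i)) big_split /= -mulr_sumr -!mulr_suml -aE.
by rewrite divff ?gt_eqF // mul1r addrK.
Qed.

Lemma truncation_arith (A B e a b EA EB la lb : R) :
  0 <= A -> 0 <= B -> 0 < e -> e <= 1 / 8 -> 1 - e <= a -> 1 - e <= b -> a <= 1 -> b <= 1 ->
  la <= 2 * e -> lb <= 2 * e -> A - e <= EA -> B - e <= EB -> 0 <= EA - la ->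
  A / 2 + B / 2 + 1 / 8 - e * (4 + A + B) <=
   b * (EA - la) / 2 + a * (EB - lb) / 2 + a * b / 8.
Proof.
move=> A0 B0 e0 e8 ha hb a1 b1 hla hlb hA hB hp.
have h1 : (1 - e) * (EA - la) <= b * (EA - la) by apply: ler_wpM2r.
have h2 : (1 - e) * (A - 3 * e) <= (1 - e) * (EA - la) by apply: ler_wpM2l; lra.
have h3 : a * (B - 3 * e) <= a * (EB - lb) by apply: ler_wpM2l; lra.
have h4 : (1 - e) * B <= a * B by apply: ler_wpM2r.
have h5 : a * e <= e by rewrite ler_piMl // ltW.
have h6 : (1 - e) * (1 - e) <= a * b by apply: ler_pM; lra.
have h7 : 0 <= e * A by rewrite mulr_ge0 // ltW.
have h8 : 0 <= e * B by rewrite mulr_ge0 // ltW.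
have h9 : 0 <= e * e by rewrite mulr_ge0 // ltW.
nra.
Qed.

(** Real lower bounds [A] and [B] stand in for the entropies, which may be infinite; [real_gain]
    lets one of them grow in that case. *)
Lemma real_gain_lower (X Y : {dRV P >-> R}) (A B eps : R) :
  independent_RV P X Y -> 0 < eps -> eps < 1 / 2 ->
  110 * 100 + 3 <= A -> 0 <= B ->
  (A%:E <= entropy P X)%E -> (B%:E <= entropy P Y)%E ->
  ((A / 2 + B / 2 + 1 / 8 - eps)%:E <= entropy P (X \+ Y)%R)%E.
Proof.
move=> indep e0 e2 hA hB AX BY.
have mX x : measurable (X @^-1` [set x]).
  by rewrite -[Z in measurable Z]setTI; exact: measurable_funP.
have mY x : measurable (Y @^-1` [set x]).
  by rewrite -[Z in measurable Z]setTI; exact: measurable_funP.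
have mZ z : measurable ((fun t => X t + Y t) @^-1` [set z]).
  by rewrite -[Z in measurable Z]setTI; apply: measurable_realfun.measurable_funD.
have indep' x y : P (X @^-1` [set x] `&` Y @^-1` [set y]) =
  (P (X @^-1` [set x]) * P (Y @^-1` [set y]))%E by apply: indep.
(* Makes the total loss [e * (4 + A + B)] in [truncation_arith] equal to [eps]. *)
pose e := eps / (4 + A + B).
have D0 : 0 < 4 + A + B by lra.
have ee : e * (4 + A + B) = eps by rewrite /e divfK // gt_eqF.
have ep : 0 < e by rewrite divr_gt0.
have e8 : e <= 1 / 8 by rewrite /e ler_pdivrMr //; lra.
have [s us [sA sm]] := entropy_approx ep AX.
have [r ur [rB rm]] := entropy_approx ep BY.
pose u (i : 'I_(size s)) := s`_i; pose v (j : 'I_(size r)) := r`_j.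
have uinj : injective u.
  by move=> i j /eqP; rewrite nth_uniq // => /eqP /val_inj.
have vinj : injective v.
  by move=> i j /eqP; rewrite nth_uniq // => /eqP /val_inj.
pose f i := mass P X (u i); pose g j := mass P Y (v j).
have a1 := sum_mass_le1 P mX us; have b1 := sum_mass_le1 P mY ur.
rewrite (big_nth 0) big_mkord in sA; rewrite (big_nth 0) big_mkord in sm.
rewrite (big_nth 0) big_mkord in rB; rewrite (big_nth 0) big_mkord in rm.
rewrite (big_nth 0) big_mkord in a1; rewrite (big_nth 0) big_mkord in b1.
rewrite -/(ent f) in sA; rewrite -/(ent g) in rB.
set a := \sum_i _ in sm a1; set b := \sum_i _ in rm b1.
have a0 : 0 < a by lra.
have b0 : 0 < b by lra.
have f0 i : 0 <= f i by exact: mass_ge0.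
have g0 i : 0 <= g i by exact: mass_ge0.
have := entropy_sum_ge mX mY mZ indep' uinj vinj (erefl a) (erefl b) a0 b0.
apply: le_trans; rewrite lee_fin.
set F := fun i => _; set H := fun j => _.
have pF : prob F.
  split; first by move=> i; apply: divr_ge0; [exact: mass_ge0 | exact: ltW].
  by rewrite -mulr_suml divff // gt_eqF.
have pH : prob H.
  split; first by move=> i; apply: divr_ge0; [exact: mass_ge0 | exact: ltW].
  by rewrite -mulr_suml divff // gt_eqF.
have EF : a * ent F = ent f - plogp a by apply: ent_normalize.
have EH : b * ent H = ent g - plogp b by apply: ent_normalize.
have la := plogp_le_compl (ltW a0) a1; have lb := plogp_le_compl (ltW b0) b1.
have F0 : 0 <= ent F.
  by rewrite sumr_ge0 // => i _; apply: plogp_ge0; [case: pF|exact: prob_le1].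
(* The 3 added to the bound on [A] covers the truncation loss [e] and [plogp a], which is at most
   [2 * e]. *)
have hF : 110 * 100 <= ent F.
  have : a * ent F <= ent F by rewrite ler_piMl.
  rewrite EF; lra.
have /(ler_wpM2l (mulr_ge0 (ltW a0) (ltW b0))) := finite_ordered_gain pF pH uinj vinj hF.
apply: le_trans.
have -> : a * b * ((ent F + ent H) / 2 + 1 / 8) =
   b * (ent f - plogp a) / 2 + a * (ent g - plogp b) / 2 + a * b / 8.
  by rewrite -EF -EH; field.
rewrite -ee; apply: truncation_arith => //; try lra.
Qed.

Lemma real_gain (X Y : {dRV P >-> R}) (eps : R) :
  independent_RV P X Y -> 0 < eps -> eps < 1 / 2 ->
  ((110 * 100 + 3)%:E <= entropy P X)%E ->
  ((1 / 2)%:E * entropy P X + (1 / 2)%:E * entropy P Y + (1 / 8 - eps)%:E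
    <= entropy P (X \+ Y)%R)%E.
Proof.
move=> indep e0 e2 hX.
have mX x : measurable (X @^-1` [set x]).
  by rewrite -[Z in measurable Z]setTI; exact: measurable_funP.
have mY x : measurable (Y @^-1` [set x]).
  by rewrite -[Z in measurable Z]setTI; exact: measurable_funP.
have hY : (0 <= entropy P Y)%E by apply: entropy_ge0.
have key A B := @real_gain_lower X Y A B eps indep e0 e2.
have half0 : (0 < (1 / 2)%:E :> \bar R)%E by rewrite lte_fin; lra.
(* With [A] above [2 * r], the lower bound for the sum exceeds [r]. *)
have infX : entropy P X = +oo%E -> entropy P (X \+ Y)%R = +oo%E.
  move=> EX; apply/eqyP => r r0.
  apply: le_trans (key (2 * r + (110 * 100 + 3)) 0 _ _ _ hY); rewrite ?EX ?leey // ?lee_fin; lra.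
have infY : entropy P Y = +oo%E -> entropy P (X \+ Y)%R = +oo%E.
  move=> EY; apply/eqyP => r r0.
  apply: le_trans (key (110 * 100 + 3) (2 * r) _ _ hX _); rewrite ?EY ?leey // ?lee_fin; lra.
case EX : (entropy P X) hX infX key => [A| |] hX infX key; last by [].
  case EY : (entropy P Y) hY infY key => [B| |] hY infY key; last by [].
    rewrite -!EFinM -!EFinD.
    rewrite (_ : 1 / 2 * A + 1 / 2 * B + (1 / 8 - eps) = A / 2 + B / 2 + 1 / 8 - eps); last by field.
    by apply: key.
  by rewrite infY // leey.
by rewrite infX // leey.
Qed.

End Real.

Theorem theorem2p7 (R : realType) (eps : R) (eps_gt0 : 0 < eps)
    (eps_lt : eps < 1 / 2) :
  exists k K h : R,
    (forall (p : nat) (d : measure_display) (T : measurableType d)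
        (P : probability T R) (X Y : {dRV P >-> 'F_p}),
      prime p ->
      independent_RV P X Y ->
      (h%:E <= entropy P X)%E ->
      k + K <= log2 (p%:R : R) ->
      (k%:E < entropy P X)%E ->
      (entropy P X < (log2 (p%:R : R) - K)%:E)%E ->
      ((1 / 2)%:E * entropy P X + (1 / 2)%:E * entropy P Y
         + (1 / 8 - eps)%:E <= entropy P (X \+ Y)%R)%E) /\
    (forall (d : measure_display) (T : measurableType d)
        (P : probability T R) (X Y : {dRV P >-> R}),
      independent_RV P X Y ->
      (h%:E <= entropy P X)%E ->
      ((1 / 2)%:E * entropy P X + (1 / 2)%:E * entropy P Y
         + (1 / 8 - eps)%:E <= entropy P (X \+ Y)%R)%E).
Proof.
(* 2000 is the distance to log p that [tail_gain_le] consumes; 11000 comes from [gain_reduce], and 3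
   from the truncation on R. *)
exists 0, (20 * 100), (110 * 100 + 3); split; last first.
  by move=> d T P X Y indep hX; exact: real_gain.
move=> p d T P X Y pp indep hX _ _ Xp.
have hX' : ((110 * 100)%:E <= entropy P X)%E.
  by apply: le_trans hX; rewrite lee_fin lerDl.
apply: le_trans (cyclic_gain pp indep hX' Xp).
by apply: leeD2l; rewrite lee_fin gerBl ltW.
Qed.
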